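(* Let $d\ge 1$ and let $(c_{m,n})_{m,n\in\mathbb N^d}$ be a $2d$-sequence of complex numbers. Then $(c_{m,n})_{m,n\in\mathbb N^d}$ is a ($d$-dimensional complex) moment $2d$-sequence if and only if there is a family $\{\mu_\xi\}_{\xi\in\Xi}$ of positive measures on $\mathbb C^d$ such that $$c_{m,n}^\xi=\int_{\mathbb C^d}z^m\bar z^n\,\mu_\xi(\mathrm dz),\qquad m,n\in \mathsf N_1,\ \xi\in\Xi,$$ and $$\mu_0=0,\qquad \mu_{\xi+\eta}+\mu_{\xi-\eta}-2\mu_\eta\ge 0,\qquad \xi,\eta\in\Xi.$$
   Context: $\mathbb N=\{0,1,2,\dots\}$. For $n=(n_1,\dots,n_d)\in\mathbb N^d$ and $z=(z_1,\dots,z_d)\in\mathbb C^d$, put $|n|=n_1+\cdots+n_d$, $z^n=z_1^{n_1}\cdots z_d^{n_d}$ and $\bar z^n=\bar z_1^{n_1}\cdots\bar z_d^{n_d}$. Measures are Borel measures, and all integrals written are understood to exist (the integrands are absolutely integrable). A $2d$-sequence $(c_{m,n})_{m,n\in\mathbb N^d}$ is a ($d$-dimensional complex) moment $2d$-sequence if there is a positive measure $\nu$ on $\mathbb C^d$ such that $c_{m,n}=\int_{\mathbb C^d}z^m\bar z^n\,\nu(\mathrm dz)$ for all $m,n\in\mathbb N^d$. $\Xi$ denotes the complex linear space of all $d$-sequences $\xi=(\xi_n)_{n\in\mathbb N^d}$ of complex numbers which are zero for all but finitely many $n$. For $\xi\in\Xi$ define $$c_{m,n}^\xi=\sum_{k,l\in\mathbb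 N^d}c_{m+k,n+l}\,\xi_k\overline{\xi_l},\qquad m,n\in\mathbb N^d.$$ $\mathsf N_1=\{k\in\mathbb N^d:\ |k|\le 1\}$. In the condition $\mu_0=0$, the index $0$ is the zero element of $\Xi$; the inequality $\mu_{\xi+\eta}+\mu_{\xi-\eta}-2\mu_\eta\ge0$ means that this signed measure is positive, i.e. nonnegative on every Borel set. *)

(* Defs.v *)
From HB Require Import structures.
From mathcomp Require Import all_boot all_order all_algebra.
From mathcomp Require Import complex finmap.
From mathcomp Require Import monalg.
From mathcomp Require Import all_classical all_reals all_analysis.

Set Implicit Arguments.
Unset Strict Implicit.
Unset Printing Implicit Defensive.

Import Order.TTheory GRing.Theory Num.Theory.
Import numFieldNormedType.Exports.

Local Open Scope classical_set_scope.
Local Open Scope ring_scope.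

Notation mindex d := {ffun 'I_d -> nat}.

Definition mlen (d : nat) (n : mindex d) : nat := (\sum_(j < d) n j)%N.

(* The regular algebra R[i]^o carries the topology given by the modulus; the
   row vectors carry the product topology. *)
Notation cspace R d := 'rV[R[i]^o]_d.

Notation borelC R d :=
  (g_sigma_algebraType (@open (cspace R d : topologicalType))).

Definition zmonom (R : realType) (d : nat) (n : mindex d) (z : cspace R d)
    : R[i] := \prod_(j < d) (z ord0 j : R[i]) ^+ n j.

Definition zbarmonom (R : realType) (d : nat) (n : mindex d) (z : cspace R d)
    : R[i] := \prod_(j < d) (Num.conj (z ord0 j : R[i])) ^+ n j.

(* The integral of f exists (absolutely) and is equal to v. *)
Definition has_cintegral (disp : measure_display) (T : measurableType disp)
    (R : realType) (mu : {measure set T -> \bar R}) (f : T -> R[i])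
    (v : R[i]) : Prop :=
  [/\ mu.-integrable setT (EFin \o (fun x => complex.Re (f x))),
      mu.-integrable setT (EFin \o (fun x => complex.Im (f x))) &
      v = Complex (Rintegral mu setT (fun x => complex.Re (f x)))
                  (Rintegral mu setT (fun x => complex.Im (f x)))].

Definition is_moment (R : realType) (d : nat)
    (c : mindex d -> mindex d -> R[i]) : Prop :=
  exists nu : {measure set (borelC R d) -> \bar R},
    forall m n : mindex d,
      has_cintegral nu (fun z => zmonom m z * zbarmonom n z) (c m n).

(* Finitely supported functions; only the pointwise linear structure is used. *)
Notation Xi R d := {malg R[i][mindex d]}.

(* All terms with k or l outside the support of xi vanish. *)
Definition cxi (R : realType) (d : nat) (c : mindex d -> mindex d -> R[i])
    (xi : Xi R d) (m n : mindex d) : R[i] :=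
  \sum_(k <- msupp xi) \sum_(l <- msupp xi)
    c (m + k) (n + l) * xi@_k * Num.conj xi@_l.

(* Main.v *)
Require Import Defs.
From HB Require Import structures.
From mathcomp Require Import all_boot all_order all_algebra.
From mathcomp Require Import complex finmap.
From mathcomp Require Import monalg.
From mathcomp Require Import all_classical all_reals all_analysis.
From mathcomp Require Import measurable_realfun ring lra.

Set Implicit Arguments.
Unset Strict Implicit.
Unset Printing Implicit Defensive.

Import Order.TTheory GRing.Theory Num.Theory.
Import numFieldNormedType.Exports.

Local Open Scope classical_set_scope.
Local Open Scope ring_scope.

(** Call D_u F (x) = F (x + u) + F (x - u) - 2 F x the second difference of F.

    If c is the moment family of nu, then mu_xi is nu with density |p_xi|^2,
    where p_xi (z) is the sum of the xi_k z^k; the convexity condition holds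
    because xi |-> |p_xi|^2 satisfies the parallelogram law.

    Conversely, let a family mu be given.  Exchanging eta and - eta in the
    inequality shows that mu is even, hence xi |-> mu_xi(A) is convex for every
    Borel set A, and its second differences in the direction xi are bounded by
    those of a quadratic form, the total mass plus the second moments.  The
    function xi |-> mu_xi(A) need not be quadratic, but an average of its second
    differences is.  For a finite list S of directions and a large m, average
    the second differences with step xi / m over points u / m, with u in an
    almost S-invariant list (folner_list), smoothed by hat functions of width
    one in the directions delta_0 and i delta_0; multiply by m^2 / 2 and pass to
    an ultralimit over S and m.  The result Lam (quadratic_mean) is positive,
    satisfies the parallelogram law exactly, and fixes every function that was
    quadratic from the start.  Symmetrizing over xi and i xi yields functionals
    L f xi (exists_functional), defined for measurable f of at most quadratic
    growth, which are Hermitian quadratic forms in xi with the prescribed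
    moments in the degrees 0 and 1.

    Because of the hat functions, L 1_A delta_0 telescopes to values of the
    convex function xi |-> mu_xi(A) near a square, so it is at most the sum of
    the values at the four corners.  The corners define a finite measure; a
    finitely additive set function dominated by a finite measure is countably
    additive, so that f |-> L f delta_0 is integration against a measure nu on
    bounded functions (dominated_representation).

    Let polar L f be the polar form of L f.  Bounded functions tensored with Xi
    carry a positive semidefinite form (polar_psd), and the moments in the
    degrees 0 and 1 say that the difference of 1 (x) delta_(k + e_j) and
    z_j (x) delta_k has length zero.  This gives the shift relation (polar_shift),
    which turns the entry of L f at (delta_m, delta_n) into the integral of
    z^m conj(z)^n f against nu, for bounded f of bounded support (beta_delta).
    Letting f increase to 1 gives the moments of nu (functional_moment). *)

(** * Second differences and averages over finite lists *)
Lemma ultra_bounded_cvg (R : realType) (I : Type) (U : set_system I)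
    (UF : UltraFilter U) (u : I -> R) (C : R) :
  (forall i, `|u i| <= C) -> cvg (u i @[i --> U]).
Proof.
move=> uC; have PF : ProperFilter U := @ultra_proper _ _ UF.
have PuU : ProperFilter (u i @[i --> U]) := fmap_proper_filter u PF.
have Ucpt : (u i @[i --> U]) [set` `[- C, C]].
  by apply: (@filterE _ U) => i; rewrite /= in_itv /= -ler_norml uC.
have [p [_ clp]] := @segment_compact R (- C) C _ PuU Ucpt.
apply/cvg_ex; exists p => B Bp.
have [//|UnB] := in_ultra_setVsetC (u @^-1` B) UF.
by have [x [/= nBx /nBx]] := clp (~` B) B UnB Bp.
Qed.

Section SecondDifference.
Context (R : realType) (V : zmodType).
Implicit Types (F : V -> R) (x u : V).

(** The second difference of F at x in the direction u. *)
Definition sdiff F (u x : V) : R := F (x + u) + F (x - u) - 2 * F x.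

Lemma sdiff_parallelogram F u v x :
  sdiff F (u + v) x + sdiff F (u - v) x =
  sdiff F v (x + u) + sdiff F v (x - u) + 2 * sdiff F u x.
Proof.
rewrite /sdiff !opprD !opprK !addrA.
rewrite [x - u + v]addrAC.
have -> : x + v - u = x - u + v by rewrite addrAC.
ring.
Qed.

Section Convex.
Variable F : V -> R.
Hypothesis F_ge0 : forall u x, 0 <= sdiff F u x.

Lemma convex_slope u x n : n%:R * (F (x + u) - F x) <= F (x + u *+ n) - F x.
Proof.
have incr : forall n, F (x + u) - F x <= F (x + u *+ n.+1) - F (x + u *+ n).
  elim=> [|m IH]; first by rewrite mulr1n mulr0n addr0.
  apply: le_trans IH _; have := F_ge0 u (x + u *+ m.+1).
  rewrite /sdiff -!addrA -[in u *+ m.+1 + u]mulrSr [u *+ m.+1]mulrSr addrK.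
  lra.
elim: n => [|n IH]; first by rewrite mulr0n addr0 mul0r subrr.
have := incr n; rewrite -[n.+1%:R]natr1; lra.
Qed.

(** A nonnegative function that is convex along a line is bounded at a point
    of a segment by the sum of its values at the two ends. *)
Lemma convex_le_ends u x p q : (forall y, 0 <= F y) ->
  F x <= F (x + u *+ p) + F (x - u *+ q).
Proof.
move=> F0; have [h|/ltW h] := lerP (F x) (F (x + u)).
  have := convex_slope u x p.
  have := mulr_ge0 (ler0n R p) (_ : 0 <= F (x + u) - F x).
  by have := F0 (x - u *+ q); rewrite subr_ge0 => ? /(_ h); lra.
have h2 : F x <= F (x - u) by have := F_ge0 u x; rewrite /sdiff; lra.
have := convex_slope (- u) x q.
have := mulr_ge0 (ler0n R q) (_ : 0 <= F (x - u) - F x).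
rewrite mulNrn.
by have := F0 (x + u *+ p); rewrite subr_ge0 => ? /(_ h2); lra.
Qed.

End Convex.

(** The average of F over x + k u, |k| < m, with the triangular weights
    (m - |k|) / m^2: the average over all differences k = a - b, a, b < m. *)
Definition hat (m : nat) (u : V) F (x : V) : R :=
  m%:R^-2 * \sum_(a < m) \sum_(b < m) F (x + u *+ a - u *+ b).

(** The triangular weights have second difference concentrated at - m, 0, m. *)
Lemma hat_sdiff m u F x : (0 < m)%N ->
  m%:R^+2 * hat m u (sdiff F u) x = F (x + u *+ m) + F (x - u *+ m) - 2 * F x.
Proof.
move=> m0; rewrite /hat mulrA divff ?mul1r;
  last by rewrite expf_neq0 ?pnatr_eq0 -?lt0n.
pose G (a b : nat) := F (x + u *+ a - u *+ b).
transitivity (\sum_(a < m) \sum_(b < m) ((G a.+1 b - G a b) - (G a b - G a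
  b.+1))).
  apply: eq_bigr => a _; apply: eq_bigr => b _; rewrite /sdiff /G !(mulrSr u).
  rewrite !opprD !addrA.
  have -> : x + u *+ a - u *+ b + u = x + u *+ a + u - u *+ b by rewrite addrAC.
  ring.
under eq_bigr => a _ do rewrite sumrB.
rewrite sumrB exchange_big /=.
have tel (f : nat -> R) : \sum_(b < m) (f b.+1 - f b) = f m - f 0%N.
  by rewrite -(big_mkord xpredT (fun b => f b.+1 - f b)) telescope_sumr.
have tel' (f : nat -> R) : \sum_(b < m) (f b - f b.+1) = f 0%N - f m.
  by rewrite -[RHS]opprB -tel -sumrN; apply: eq_bigr => b _; rewrite opprB.
under eq_bigr => b _ do rewrite (tel (G^~ b)).
under [X in _ - X]eq_bigr => b _ do rewrite (tel' (G b)).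
have Gshift a b k : G (a + k)%N (b + k)%N = G a b.
  by rewrite /G !mulrnDr opprD !addrA [_ - u *+ b - _]addrAC addrK.
have rev : \sum_(a < m) (G a 0%N - G a m) =
    \sum_(b < m) (G m b.+1 - G 0%N b.+1).
  rewrite (reindex_inj rev_ord_inj); apply: eq_bigr => b _ /=.
  rewrite -[in X in X - _](Gshift _ _ b.+1) add0n subnK //.
  by rewrite -[in RHS](Gshift 0%N b.+1 (m - b.+1)%N) add0n subnKC.
rewrite rev -sumrB.
rewrite (eq_bigr (fun b : 'I_m => (G m b - G m b.+1) + (G 0%N b.+1 - G 0%N
  b))); last first.
  by move=> b _; ring.
rewrite big_split /= (tel' (G m)) (tel (G 0%N)) /G addrK !(mulr0n u) !subr0
  !addr0.
ring.
Qed.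

Lemma hatC m u v F x : hat m u (sdiff F v) x = sdiff (hat m u F) v x.
Proof.
rewrite /sdiff /hat mulrCA -!mulrDr -mulrBr; congr (_ * _).
rewrite mulr_sumr -big_split -sumrB; apply: eq_bigr => a _ /=.
rewrite mulr_sumr -big_split -sumrB; apply: eq_bigr => b _ /=.
rewrite -![x + v + _ - _]addrA -![x - v + _ - _]addrA.
rewrite [x + v + _]addrAC [x - v + _]addrAC !addrA.
by [].
Qed.

Lemma hat_le m u F G x : (forall y, F y <= G y) -> hat m u F x <= hat m u G x.
Proof.
move=> FG; rewrite /hat ler_wpM2l ?invr_ge0 ?exprn_ge0 //.
by apply: ler_sum => a _; apply: ler_sum => b _.
Qed.

Lemma hat_cst m u c x : (0 < m)%N -> hat m u (fun=> c) x = c.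
Proof.
move=> m0; rewrite /hat !sumr_const !card_ord -mulrnA -[c *+ _]mulr_natl mulrA.
by rewrite natrM -expr2 mulVf ?mul1r // expf_neq0 // pnatr_eq0 -lt0n.
Qed.

Lemma hat_linear m u (c : R) F G x :
  hat m u (fun y => c * F y + G y) x = c * hat m u F x + hat m u G x.
Proof.
rewrite /hat mulrCA -mulrDr; congr (_ * _).
rewrite mulr_sumr -big_split; apply: eq_bigr => a _ /=.
by rewrite mulr_sumr -big_split.
Qed.

(** Abelian groups are amenable: every finite set S of translations admits a
    nonempty finite list T that is invariant under S up to a proportion e. *)
Lemma folner_list (S : seq V) (e : R) : 0 < e ->
  exists T : seq V, (0 < size T)%N /\
    forall v (g : V -> R) (C : R), v \in S -> (forall x, `|g x| <= C) ->
      `|\sum_(t <- T) g (t + v) - \sum_(t <- T) g t| <= e * C * (size T)%:R.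
Proof.
move=> e0; elim: S => [|v S [T [T0 IH]]]; first by exists [:: 0].
have [n n0 ne] : exists2 n, (0 < n)%N & 2 <= e * n%:R.
  have [n hn] : exists n, 2 / e < n%:R by exists (Num.bound (2 / e));
    apply: archi_boundP; rewrite divr_ge0 // ltW.
  exists n.+1 => //; rewrite -ler_pdivrMl // mulrC ltW // (lt_le_trans hn) //.
  by rewrite ler_nat.
exists [seq t + v *+ j | t <- T, j <- iota 0 n]; split.
  by rewrite size_allpairs size_iota muln_gt0 T0.
move=> w g C; rewrite size_allpairs size_iota => wS gC.
have C0 : 0 <= C by rewrite (le_trans _ (gC 0)).
rewrite !big_allpairs_dep -sumrB /=.
move: wS; rewrite in_cons => /orP[/eqP ->|wS].
  apply: (@le_trans _ _ (\sum_(t <- T) (C + C))); last first.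
    rewrite big_const_seq count_predT iter_addr_0 -mulr_natr natrM.
    rewrite (_ : e * C * _ = e * n%:R * (C * (size T)%:R)); last by ring.
    rewrite -[(C + C) *+ _]mulr_natr (_ : (C + C) * _ = 2 * (C * (size T)%:R));
      last by ring.
    by rewrite ler_wpM2r // mulr_ge0.
  apply: le_trans (ler_norm_sum _ _ _) _; apply: ler_sum => t _.
  have iotaE : iota 0 n = index_iota 0 n by rewrite /index_iota subn0.
  rewrite -sumrB iotaE (eq_bigr (fun j => g (t + v *+ j.+1) - g (t + v *+ j))).
    rewrite telescope_sumr // mulr0n addr0.
    by rewrite (le_trans (ler_normB _ _)) // lerD.
  by move=> j _; rewrite mulrSr addrA.
under eq_bigr => t _ do rewrite -sumrB.
rewrite exchange_big /=.
apply: (@le_trans _ _ (\sum_(j <- iota 0 n) e * C * (size T)%:R)); last first.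
  by rewrite big_const_seq count_predT size_iota iter_addr_0 natrM mulrA -[X in
    X <= _]mulr_natr.
apply: le_trans (ler_norm_sum _ _ _) _; apply: ler_sum => j _.
have := IH w (fun x => g (x + v *+ j)) C wS (fun x => gC _).
rewrite -sumrB; under eq_bigr => t _ do rewrite addrAC.
by [].
Qed.
End SecondDifference.

(** * A mean with values in quadratic forms *)
Section Mean.
Context (R : realType) (K : numFieldType) (V : lmodType K).
Variables (W : V -> R) (u1 u2 : V).
Hypothesis W_ge0 : forall x, 0 <= W x.
Hypothesis W_scale : forall m x, (0 < m)%N -> W (m%:R^-1 *: x) = W x / m%:R ^+
  2.
Implicit Types (F G : V -> R) (T : seq V).

(** The function F on the lattice of step 1 / m. *)
Definition rescale (m : nat) F (x : V) : R := F (m%:R^-1 *: x).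

(** The average of G over the list T. *)
Definition avg T G : R := (size T)%:R^-1 * \sum_(t <- T) G t.

(** The normalized second difference of F with step x / m, averaged over t / m
    for t in T, and over hat functions of width one in the directions u1, u2. *)
Definition premean T m F (x : V) : R :=
  m%:R ^+ 2 / 2 * avg T (hat m u1 (hat m u2 (sdiff (rescale m F) x))).

(** The second differences of F in a direction are controlled by W. *)
Definition sdiff_bounded (C : R) F := forall x y, `|sdiff F x y| <= C * W x.

(** The sum of the values of F at the corners of the square spanned by u1, u2. *)
Definition corners F : R :=
  F (u1 + u2) + F (u1 - u2) + F (- u1 + u2) + F (- u1 - u2).

Lemma sdiff_rescale m F x y :
  sdiff (rescale m F) x y = sdiff F (m%:R^-1 *: x) (m%:R^-1 *: y).
Proof. by rewrite /sdiff /rescale scalerDr scalerBr. Qed.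

Lemma avg_le T F G : (forall t, t \in T -> F t <= G t) -> avg T F <= avg T G.
Proof.
by move=> FG; rewrite /avg ler_wpM2l ?invr_ge0 // !big_seq ler_sum.
Qed.

Lemma avg_cst T c : (0 < size T)%N -> avg T (fun=> c) = c.
Proof.
move=> T0; rewrite /avg big_const_seq count_predT iter_addr_0 -[c *+
  _]mulr_natl.
by rewrite mulrA mulVf ?mul1r // pnatr_eq0 -lt0n.
Qed.

Lemma avg_linear T (c : R) F G :
  avg T (fun x => c * F x + G x) = c * avg T F + avg T G.
Proof. by rewrite /avg big_split /= -mulr_sumr mulrDr mulrCA. Qed.

Lemma hat_norm_le m u F (C : R) x : (0 < m)%N -> (forall y, `|F y| <= C) ->
  `|hat m u F x| <= C.
Proof.
move=> m0 FC; rewrite ler_norml; apply/andP; split.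
  rewrite -[leLHS](hat_cst u _ x m0); apply: hat_le => y.
  by have := FC y; rewrite ler_norml => /andP[].
rewrite -[leRHS](hat_cst u _ x m0); apply: hat_le => y.
by have := FC y; rewrite ler_norml => /andP[].
Qed.

Lemma premean_hat_bound m F C x y : (0 < m)%N -> sdiff_bounded C F ->
  `|hat m u1 (hat m u2 (sdiff (rescale m F) x)) y| <= C * W x / m%:R ^+ 2.
Proof.
move=> m0 FC; do 2!(apply: hat_norm_le => // ?).
by rewrite sdiff_rescale (le_trans (FC _ _)) // W_scale // mulrA.
Qed.

Lemma premean_bound T m F C x : (0 < m)%N -> (0 < size T)%N ->
  sdiff_bounded C F -> `|premean T m F x| <= C * W x / 2.
Proof.
move=> m0 T0 FC; have m20 : 0 < m%:R ^+ 2 :> R by rewrite exprn_gt0 // ltr0n.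
rewrite /premean normrM ger0_norm; last by rewrite divr_ge0 // ltW.
rewrite (_ : C * W x / 2 = m%:R ^+ 2 / 2 * (C * W x / m%:R ^+ 2));
  last by field; rewrite pnatr_eq0 -lt0n.
rewrite ler_wpM2l ?divr_ge0 ?(ltW m20) // ler_norml; apply/andP; split.
  rewrite -[leLHS](avg_cst _ T0); apply: avg_le => t _.
  by have := premean_hat_bound x t m0 FC; rewrite ler_norml => /andP[].
rewrite -[leRHS](avg_cst _ T0); apply: avg_le => t _.
by have := premean_hat_bound x t m0 FC; rewrite ler_norml => /andP[].
Qed.

Lemma premean_ge0 T m F x : (forall u y, 0 <= sdiff F u y) -> (0 < m)%N ->
  0 <= premean T m F x.
Proof.
move=> F0 m0; rewrite /premean mulr_ge0 ?divr_ge0 ?exprn_ge0 //.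
rewrite /avg mulr_ge0 ?invr_ge0 // sumr_ge0 // => t _.
rewrite -(hat_cst u1 0 t m0) hat_le // => y.
by rewrite -(hat_cst u2 0 y m0) hat_le // => z; rewrite sdiff_rescale.
Qed.

Lemma premean_linear T m c F G x :
  premean T m (fun y => c * F y + G y) x = c * premean T m F x + premean T m G
    x.
Proof.
rewrite /premean [c * _]mulrCA -mulrDr; congr (_ * _); rewrite -avg_linear.
congr avg; apply/funext => t; rewrite -hat_linear; congr hat.
apply/funext => y; rewrite -hat_linear; congr hat.
by apply/funext => z; rewrite /sdiff /rescale; ring.
Qed.

(** Quadratic functions are left unchanged. *)
Lemma premean_quad T m F x : (0 < m)%N -> (0 < size T)%N ->
  (forall u y, sdiff F u y = 2 * F u) ->
  F (m%:R^-1 *: x) = F x / m%:R ^+ 2 -> premean T m F x = F x.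
Proof.
move=> m0 T0 Fq Fs; rewrite /premean.
rewrite (_ : sdiff _ x = fun=> 2 * (F x / m%:R ^+ 2)); last first.
  by apply/funext => y; rewrite sdiff_rescale Fq Fs.
rewrite (_ : hat m u2 _ = fun=> 2 * (F x / m%:R ^+ 2)); last first.
  by apply/funext => y; rewrite hat_cst.
rewrite (_ : hat m u1 _ = fun=> 2 * (F x / m%:R ^+ 2)); last first.
  by apply/funext => y; rewrite hat_cst.
by rewrite avg_cst //; field; rewrite pnatr_eq0 -lt0n.
Qed.

(** The parallelogram law holds up to the defect of invariance of T, because
    D_(x + y) + D_(x - y) is 2 D_x plus two translates of D_y. *)
Lemma premean_parallelogram T m F C e x y : (0 < m)%N -> (0 < size T)%N ->
  sdiff_bounded C F ->
  (forall v (g : V -> R) (D : R), v \in [:: x;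
  - x] -> (forall z, `|g z| <= D) ->
      `|\sum_(t <- T) g (t + v) - \sum_(t <- T) g t| <= e * D * (size T)%:R) ->
  `|premean T m F (x + y) + premean T m F (x - y) -
    2 * (premean T m F x + premean T m F y)| <= e * (C * W y).
Proof.
move=> m0 T0 FC fol.
pose H v := hat m u1 (hat m u2 (sdiff (rescale m F) v)).
have HP t : H (x + y) t + H (x - y) t - 2 * (H x t + H y t) =
    (H y (t + x) - H y t) + (H y (t - x) - H y t).
  have HE v z : H v z = sdiff (hat m u1 (hat m u2 (rescale m F))) v z.
    by rewrite /H -hatC; congr hat; apply/funext => w; rewrite hatC.
  rewrite !HE sdiff_parallelogram; ring.
have m20 : 0 < m%:R ^+ 2 :> R by rewrite exprn_gt0 // ltr0n.
have s0 : 0 < (size T)%:R :> R by rewrite ltr0n.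
rewrite (_ : _ - _ = m%:R ^+ 2 / 2 / (size T)%:R *
   ((\sum_(t <- T) H y (t + x) - \sum_(t <- T) H y t) +
    (\sum_(t <- T) H y (t - x) - \sum_(t <- T) H y t))); last first.
  rewrite -!sumrB -big_split /= -(eq_bigr _ (fun t _ => HP t)) /= sumrB
    -mulr_sumr !big_split /=.
  by rewrite /premean /avg -!/(H _) ; ring.
have HC z := premean_hat_bound y z m0 FC.
have h1 := fol x (H y) _ (mem_head _ _) (fun z => HC z).
have h2 := fol (- x) (H y) _ (mem_last x [:: - x]) (fun z => HC z).
rewrite normrM ger0_norm ?divr_ge0 ?(ltW m20) ?(ltW s0) //.
have {h1 h2} h12 := le_trans (ler_normD _ _) (lerD h1 h2).
rewrite (_ : e * (C * W y) = m%:R ^+ 2 / 2 / (size T)%:R *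
   (e * (C * W y / m%:R ^+ 2) * (size T)%:R + e * (C * W y / m%:R ^+ 2) * (size
   T)%:R)).
  by rewrite ler_wpM2l // ?divr_ge0 // ?(ltW m20) ?(ltW s0).
by field; rewrite !pnatr_eq0 -!lt0n m0.
Qed.

Lemma hat_comm m u v F x : hat m u (hat m v F) x = hat m v (hat m u F) x.
Proof.
rewrite /hat; congr (_ * _).
under eq_bigr => a _ do rewrite -mulr_sumr exchange_big /=.
rewrite -mulr_sumr exchange_big /=.
under [RHS]eq_bigr => a _ do rewrite -mulr_sumr.
rewrite -mulr_sumr; congr (_ * _); apply: eq_bigr => a _.
under eq_bigr => i _ do rewrite exchange_big /=.
rewrite exchange_big; apply: eq_bigr => b _.
apply: eq_bigr => i _; apply: eq_bigr => j _; congr F.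
by rewrite -!addrA; congr (_ + _); rewrite addrA addrC -addrA.
Qed.

Lemma hat_le_ends m u F y : (forall v z, 0 <= sdiff F v z) ->
  (forall z, 0 <= F z) -> (0 < m)%N ->
  hat m u F y <= F (y + u *+ m) + F (y - u *+ m).
Proof.
move=> F2 F0 m0; rewrite -[leRHS](hat_cst u _ y m0) /hat.
rewrite ler_wpM2l ?invr_ge0 ?exprn_ge0 //.
apply: ler_sum => a _; apply: ler_sum => b _.
have := convex_le_ends F2 u (y + u *+ a - u *+ b) (m - a + b) (m - b + a) F0.
rewrite (_ : _ + u *+ (m - a + b) = y + u *+ m); last first.
  by rewrite mulrnDr [u *+ _ + _]addrC addrA subrK -addrA -mulrnDr subnKC //
    ltnW.
rewrite (_ : _ - u *+ (m - b + a) = y - u *+ m) //.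
rewrite [(_ + a)%N]addnC mulrnDr opprD addrA [y + _ - _]addrAC addrK -addrA.
by rewrite -opprD -mulrnDr subnKC // ltnW.
Qed.

(** In the directions u1 and u2 the mean is bounded by the values of a convex F
    at the corners, up to an error that the choice of m makes small. *)
Lemma premean_corners T m F C e x : (0 < m)%N -> (0 < size T)%N ->
  (forall v z, 0 <= sdiff F v z) -> (forall z, 0 <= F z) ->
  (forall z, F z <= C * W z) -> 0 <= C ->
  (forall t s, t \in T -> s \in [:: u1 + u2; u1 - u2; - u1 + u2; - u1 - u2] ->
     W (s + t) <= e * m%:R) ->
  x \in [:: u1; u2] ->
  premean T m F x <= (corners F + 4 * (C * e)) / 2.
Proof.
move=> m0 T0 F2 F0 FW C0 Wt xu.
have m20 : 0 < m%:R ^+ 2 :> R by rewrite exprn_gt0 // ltr0n.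
have F'2 v z : 0 <= sdiff (rescale m F) v z by rewrite sdiff_rescale.
have F'0 z : 0 <= rescale m F z by exact: F0.
have key t s : t \in T -> s \in [:: u1 + u2; u1 - u2; - u1 + u2; - u1 - u2] ->
    rescale m F (t + s *+ m) <= F s + C * e.
  move=> tT sC; rewrite /rescale scalerDr -[s *+ m]scaler_nat scalerA mulVf
    ?pnatr_eq0 -?lt0n // scale1r.
  have := convex_slope F2 (m%:R^-1 *: t) s m.
  rewrite -[(_ *: t) *+ m]scaler_nat scalerA mulfV ?pnatr_eq0 -?lt0n // scale1r
    [s + _ *: _]addrC => h.
  have h2 : m%:R * (F (m%:R^-1 *: t + s) - F s) <= m%:R * (C * e).
    rewrite (le_trans h) // lerBlDr (le_trans (FW _)) // (le_trans (ler_wpM2l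
      C0 (Wt _ _ tT sC))) //.
    rewrite (_ : C * (e * m%:R) = m%:R * (C * e)) ?lerDl //; ring.
  by move: h2; rewrite ler_pM2l ?ltr0n // lerBlDl.
suff step t : t \in T ->
    m%:R ^+ 2 * hat m u1 (hat m u2 (sdiff (rescale m F) x)) t <= corners F + 4
      * (C * e).
  rewrite /premean mulrAC ler_wpM2r ?invr_ge0 //.
  rewrite -[leRHS](avg_cst _ T0) /avg mulrCA ler_wpM2l ?invr_ge0 //.
  by rewrite mulr_sumr !big_seq ler_sum.
move=> tT.
suff : m%:R ^+ 2 * hat m u1 (hat m u2 (sdiff (rescale m F) x)) t <=
    rescale m F (t + (u1 + u2) *+ m) + rescale m F (t + (u1 - u2) *+ m) +
    rescale m F (t + (- u1 + u2) *+ m) + rescale m F (t + (- u1 - u2) *+ m).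
  have inl (a b c d : V) : [/\ a \in [:: a; b; c; d], b \in [:: a; b; c; d],
     c \in [:: a; b; c; d] & d \in [:: a; b; c; d]] by rewrite !inE !eqxx !orbT.
  have [i1 i2 i3 i4] := inl (u1 + u2) (u1 - u2) (- u1 + u2) (- u1 - u2).
  have := key _ _ tT i1; have := key _ _ tT i2; have := key _ _ tT i3;
    have := key _ _ tT i4.
  by rewrite /corners; lra.
have bnd u z := hat_le_ends (m := m) u z F'2 F'0 m0.
have hat0 u z : 0 <= hat m u (rescale m F) z.
  by rewrite -(hat_cst u 0 z m0) hat_le.
rewrite ![(_ + _) *+ m]mulrnDl !mulNrn !addrA.
move: xu; rewrite !inE => /orP[] /eqP ->.
  rewrite (_ : hat m u2 _ = sdiff (hat m u2 (rescale m F)) u1); last first.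
    by apply/funext => z; rewrite hatC.
  rewrite hat_sdiff //.
  have := bnd u2 (t + u1 *+ m); have := bnd u2 (t - u1 *+ m); have := hat0 u2 t.
  lra.
rewrite hat_comm (_ : hat m u1 _ = sdiff (hat m u1 (rescale m F)) u2);
  last first.
  by apply/funext => z; rewrite hatC.
rewrite hat_sdiff //.
have := bnd u1 (t + u2 *+ m); have := bnd u1 (t - u2 *+ m); have := hat0 u1 t.
rewrite [t + u2 *+ m + _]addrAC [t + u2 *+ m - _]addrAC [t - u2 *+ m + _]addrAC
  [t - u2 *+ m - _]addrAC.
lra.
Qed.

End Mean.

Section MeanExists.
Context (R : realType) (K : numFieldType) (V : lmodType K).
Variables (W : V -> R) (u1 u2 : V).
Hypothesis W_ge0 : forall x, 0 <= W x.
Hypothesis W_scale : forall m x, (0 < m)%N -> W (m%:R^-1 *: x) = W x / m%:R ^+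
  2.
Implicit Types (F G : V -> R) (T S : seq V).

(** A list almost invariant under S, with a scale m so large that moving the
    corners by t / m, t in T, is harmless. *)
Lemma folner_scale S (e : R) : 0 < e -> exists Tm : seq V * nat,
  [/\ (0 < size Tm.1)%N, (0 < Tm.2)%N,
    forall v (g : V -> R) (C : R), v \in S -> (forall x, `|g x| <= C) ->
      `|\sum_(t <- Tm.1) g (t + v) - \sum_(t <- Tm.1) g t|
         <= e * C * (size Tm.1)%:R &
    forall t s, t \in Tm.1 ->
      s \in [:: u1 + u2; u1 - u2; - u1 + u2; - u1 - u2] ->
      W (s + t) <= e * Tm.2%:R].
Proof.
move=> e0; have [T [T0 Tf]] := folner_list S e0.
pose B : R := \sum_(t <- T) \sum_(s <- [:: u1 + u2; u1 - u2; - u1 + u2;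
  - u1 - u2]) W (s + t).
have [m mB] : exists m : nat, B / e <= m.+1%:R.
  exists (Num.bound (B / e)); rewrite ltW // (lt_le_trans (archi_boundP _))
    ?ler_nat //.
  by rewrite divr_ge0 ?(ltW e0) // sumr_ge0 // => t _; rewrite sumr_ge0.
exists (T, m.+1); split=> //= t s tT sC.
apply: (@le_trans _ _ B); last by rewrite mulrC -ler_pdivrMr.
rewrite /B (big_rem t) //= (big_rem s) //= -addrA lerDl addr_ge0 //.
  by rewrite sumr_ge0.
by rewrite sumr_ge0 // => ? _; rewrite sumr_ge0.
Qed.

(** The ultralimit of the averages, over finite lists S ordered by inclusion and
    precisions 1 / (n + 1): a positive linear operation that turns functions
    with bounded second differences into quadratic forms. *)
Lemma quadratic_mean : exists L : (V -> R) -> V -> R,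
  [/\ forall a F G C D x, sdiff_bounded W C F -> sdiff_bounded W D G ->
        L (fun y => a * F y + G y) x = a * L F x + L G x,
      forall F C x, sdiff_bounded W C F -> (forall u y, 0 <= sdiff F u y) ->
        0 <= L F x,
      forall F C x y, sdiff_bounded W C F ->
        L F (x + y) + L F (x - y) = 2 * (L F x + L F y),
      forall F x, (forall u y, sdiff F u y = 2 * F u) ->
        (forall m, (0 < m)%N -> F (m%:R^-1 *: x) = F x / m%:R ^+ 2) ->
        L F x = F x &
      forall F C D x, sdiff_bounded W D F -> (forall u y, 0 <= sdiff F u y) ->
        (forall y, 0 <= F y) -> (forall y, F y <= C * W y) -> 0 <= C ->
        x \in [:: u1; u2] -> L F x <= corners u1 u2 F / 2].
Proof.
pose eps (n : nat) : R := n.+1%:R^-1.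
have eps0 n : 0 < eps n by rewrite invr_gt0.
have [f fP] := choice (fun Sn : seq V * nat => folner_scale Sn.1 (eps0 Sn.2)).
(* The filter of the pairs (S, n) that are eventually large. *)
pose base (Sn : seq V * nat) : set (seq V * nat) :=
  [set Tk : seq V * nat | {subset Sn.1 <= Tk.1} /\ (Sn.2 <= Tk.2)%N].
pose Fil := [set P | exists Sn, base Sn `<=` P].
have FilP : ProperFilter Fil.
  apply: Build_ProperFilter.
    by move=> [Sn /(_ Sn)]; apply; split=> //=.
  split.
  - by exists ([::], 0%N).
  - move=> P Q [[S1 n1] h1] [[S2 n2] h2]; exists (S1 ++ S2, maxn n1 n2).
    move=> [S3 n3] [/= hS]; rewrite geq_max => /andP[l1 l2]; split.
      by apply: h1; split=> //= v vS; apply: hS; rewrite mem_cat vS.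
    by apply: h2; split=> //= v vS; apply: hS; rewrite mem_cat vS orbT.
  - by move=> P Q PQ [Sn h]; exists Sn => x /h /PQ.
have [U [UF FilU]] := ultraFilterLemma FilP.
have UP : ProperFilter U := @ultra_proper _ _ UF.
pose l F x (i : seq V * nat) := premean u1 u2 (f i).1 (f i).2 F x.
pose L F x : R := lim (l F x i @[i --> U]).
have lC F C x : sdiff_bounded W C F -> cvg (l F x i @[i --> U]).
  move=> FC; apply: (@ultra_bounded_cvg _ _ _ UF _ (C * W x / 2)) => i.
  by case: (fP i) => T0 m0 _ _; apply: premean_bound.
(* A bound by a multiple of 1 / (n + 1), valid for all S large enough,
   forces the ultralimit to be nonpositive. *)
have eps_cvg c (g : seq V * nat -> R) : cvg (g i @[i --> U]) ->
    (exists S, forall i, {subset S <= i.1} -> g i <= eps i.2 * c) -> lim (g i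
    @[i --> U]) <= 0.
  move=> gc [S hS]; apply/ler_addgt0Pr => e e0; rewrite add0r.
  apply: limr_le => //; apply: FilU.
  exists (S, Num.bound (`|c| / e)) => -[S' n] [/= SS' ln].
  apply: (le_trans (hS (S', n) SS')) => /=.
  apply: (@le_trans _ _ (eps n * `|c|));
    first by rewrite ler_wpM2l ?ler_norm // ltW.
  rewrite /eps mulrC ler_pdivrMr // mulrC -ler_pdivrMr // ltW //.
  by rewrite (lt_le_trans (archi_boundP _)) ?divr_ge0 ?(ltW e0) // ler_nat ltnW.
have Llin a F G C D x : sdiff_bounded W C F -> sdiff_bounded W D G ->
        L (fun y => a * F y + G y) x = a * L F x + L G x.
  move=> FC GD; apply: cvg_lim => //.
  rewrite (_ : (fun i => _) = (fun i => a * l F x i + l G x i)); last first.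
    by apply/funext => i; rewrite /l premean_linear.
  by apply: cvgD; [apply: cvgMr|]; [apply: (lC _ C)|apply: (lC _ D)].
exists L; split => //.
- move=> F C x FC F2; apply: limr_ge; first exact: (lC _ C).
  by apply: (@filterE _ U) => i; case: (fP i) => T0 m0 _ _; apply: premean_ge0.
- move=> F C x y FC.
  pose g i := l F (x + y) i + l F (x - y) i - 2 * (l F x i + l F y i).
  have gL : g i @[i --> U] --> L F (x + y) + L F (x - y) - 2 * (L F x + L F y).
    apply: cvgB; first by apply: cvgD; apply: (lC _ C).
    by apply: cvgMr; apply: cvgD; apply: (lC _ C).
  have gB i : {subset [:: x; - x] <= i.1} -> `|g i| <= eps i.2 * (C * W y).
    move=> xi; case: (fP i) => T0 m0 fol _; apply: premean_parallelogram => //.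
    by move=> v g' D /xi vi; apply: fol.
  apply/eqP; rewrite -subr_eq0 eq_le; apply/andP; split.
    rewrite -(cvg_lim _ gL) //; apply: (eps_cvg (C * W y)).
      by apply/cvg_ex; eexists; exact: gL.
    by exists [:: x; - x] => i /gB /(le_trans (ler_norm _)).
  rewrite -oppr_le0 -(cvg_lim _ (cvgN gL)) //; apply: (eps_cvg (C * W y)).
    by apply/cvg_ex; eexists; exact: (cvgN gL).
  exists [:: x; - x] => i /gB; rewrite -normrN; exact/le_trans/ler_norm.
- move=> F x Fq Fs; rewrite /L (_ : l F x = fun=> F x) ?lim_cst //.
  apply/funext => i; case: (fP i) => T0 m0 _ _.
  by rewrite /l premean_quad // Fs.
- move=> F C D x FD F2 F0 FW C0 xu; rewrite -subr_le0.
  have h : (l F x i - corners u1 u2 F / 2) @[i --> U] --> L F x - corners u1 u2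
    F / 2.
    by apply: cvgB; [apply: (lC _ D)|apply: cvg_cst].
  rewrite -(cvg_lim _ h) //; apply: (eps_cvg (2 * C)).
    by apply/cvg_ex; eexists; exact: h.
  exists [::] => i _; case: (fP i) => T0 m0 _ Wi.
  have := premean_corners m0 T0 F2 F0 FW C0 Wi xu.
  rewrite /l => h'; rewrite lerBlDl (le_trans h') //.
by rewrite mulrDl lerD //; lra.
Qed.

End MeanExists.

(** * Functionals that are quadratic in a vector *)
Section Quantize.
Context (R : realType) disp (T : measurableType disp).

(** Finitely many bounded measurable functions are simultaneously within 1 / n
    of functions with finitely many values, all of them in (1 / n) Z. *)
Lemma quantize (p : nat) (f : 'I_p -> T -> R) (K n : nat) : (0 < n)%N ->
  (forall a, measurable_fun setT (f a)) -> (forall a t, `|f a t| <= K%:R) ->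
  exists N (k : T -> {ffun 'I_p -> 'I_N}) (v : 'I_N -> int),
    (forall j, measurable (k @^-1` [set j])) /\
    (forall a t, `|f a t - (v (k t a))%:~R / n%:R| <= n%:R^-1).
Proof.
move=> n0 mf fK; have n0R : 0 < n%:R :> R by rewrite ltr0n.
pose N := ((K + K) * n)%N.
(* Shifting by K makes the function nonnegative, so that integer parts can be
   taken in nat. *)
pose g a t := n%:R * (f a t + K%:R).
have g0 a t : 0 <= g a t.
  have := fK a t; rewrite ler_norml => /andP[h _].
  by rewrite /g mulr_ge0 // -lerBlDr sub0r.
have gN a t : (Num.truncn (g a t) < N.+1)%N.
  have /andP[h _] := truncn_itv (g0 a t).
  rewrite ltnS -(ler_nat R) (le_trans h) //.
  rewrite /N natrM /g mulrC ler_pM2r // natrD lerD2r.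
  by rewrite (le_trans (ler_norm _)).
exists N.+1, (fun t => [ffun a => Ordinal (gN a t)]), (fun j => j%:Z - (K *
  n)%:Z); split.
  move=> j; rewrite (_ : _ @^-1` _ = \bigcap_(a in setT) (setT `&`
      f a @^-1` `[(j a)%:R / n%:R - K%:R, (j a).+1%:R / n%:R - K%:R[)).
    by apply: fin_bigcap_measurable => [|a _]; [exact: finite_finset|exact: mf].
  have memE t a : (f a t \in `[(j a)%:R / n%:R - K%:R, (j a).+1%:R / n%:R -
    K%:R[) =
      (Num.truncn (g a t) == j a).
    rewrite truncn_eq // /g /= in_itv /= lerBlDr ltrBrDr.
    by rewrite ler_pdivrMr // ltr_pdivlMr // ![_ * n%:R]mulrC.
  apply/seteqP; split => t /=.
    by move=> jE a _; split=> //=; rewrite memE -jE ffunE /=.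
  move=> h; apply/ffunP => a; apply/val_inj; rewrite ffunE /=.
  by case: (h a I) => _ /=; rewrite memE => /eqP.
move=> a t; rewrite ffunE /= rmorphB /= -!pmulrn natrM.
have /andP[h1 h2] := truncn_itv (g0 a t).
have -> : f a t - ((Num.truncn (g a t))%:R - K%:R * n%:R) / n%:R =
    (g a t - (Num.truncn (g a t))%:R) / n%:R.
  by rewrite /g; field; rewrite gt_eqF.
rewrite normrM normfV [X in _ / X]ger0_norm ?(ltW n0R) // ger0_norm ?subr_ge0
  //.
by rewrite ler_pdivrMr // mulVf ?gt_eqF // lerBlDl natr1 ltW.
Qed.
End Quantize.

Section Functional.
Context (R : realType) disp (T : measurableType disp).
Variable w : T -> R.

(** Measurable functions of growth at most w. *)
Definition tame (f : T -> R) :=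
  measurable_fun setT f /\ exists C, forall t, `|f t| <= C * w t.

Hypothesis w1 : forall t, 1 <= w t.
Hypothesis mw : measurable_fun setT w.
Implicit Types (f g : T -> R).

Lemma w_ge0 t : 0 <= w t. Proof. by rewrite (le_trans ler01). Qed.

Lemma tameZD a f g : tame f -> tame g -> tame (fun t => a * f t + g t).
Proof.
move=> [mf [C fC]] [mg [D gD]]; split.
  apply: measurable_funD => //; apply: measurable_funM => //;
    exact: measurable_cst.
exists (`|a| * C + D) => t; rewrite (le_trans (ler_normD _ _)) // mulrDl lerD
  //.
by rewrite normrM -mulrA ler_wpM2l.
Qed.

Lemma tame_bounded f C : measurable_fun setT f -> (forall t, `|f t| <= C) ->
  tame f.
Proof.
move=> mf fC; split=> //; exists C => t;
  rewrite (le_trans (fC t)) // ler_peMr //.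
by rewrite (le_trans _ (fC t)).
Qed.

Lemma tame_cst c : tame (fun=> c).
Proof. by apply: (@tame_bounded _ `|c|) => //; exact: measurable_cst. Qed.

Lemma tameZ a f : tame f -> tame (fun t => a * f t).
Proof.
move=> tf; have := tameZD a tf (tame_cst 0).
by under eq_fun do rewrite addr0.
Qed.

Lemma tameD f g : tame f -> tame g -> tame (fun t => f t + g t).
Proof.
move=> tf tg; have := tameZD 1 tf tg.
by under eq_fun do rewrite mul1r.
Qed.

Lemma tame_w : tame w.
Proof. by split=> //; exists 1 => t; rewrite mul1r ger0_norm // w_ge0. Qed.

Lemma tame_le f C : measurable_fun setT f -> (forall t, `|f t| <= C * w t) ->
  tame f.
Proof. by move=> mf h; split=> //; exists C. Qed.

Lemma tame_indic (A : set T) : measurable A -> tame (\1_A).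
Proof.
move=> mA; apply: (@tame_bounded _ 1); first exact: measurable_indic.
by move=> t; rewrite indicE; case: (_ \in _); rewrite ?normr1 ?normr0.
Qed.

(** For each tame f, L f is a quadratic form on V (in the sense of the
    parallelogram law); it is linear and positive in f, and invariant under the
    complex structure J. *)
Record quad_functional (V : zmodType) (J : V -> V) (L : (T -> R) -> V -> R) :
  Prop := {
  qf_lin : forall a f g x, tame f -> tame g ->
    L (fun t => a * f t + g t) x = a * L f x + L g x;
  qf_ge0 : forall f x, tame f -> (forall t, 0 <= f t) -> 0 <= L f x;
  qf_par : forall f x y, tame f -> L f (x + y) + L f (x - y) = 2 * (L f x + L f
    y);
  qf_J : forall f x, tame f -> L f (J x) = L f x;
  qf_JD : forall x y, J (x + y) = J x + J y;
  qf_JN : forall x, J (- x) = - J x;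
  qf_JJ : forall x, J (J x) = - x }.

Context (V : zmodType).
Variables (J : V -> V) (L : (T -> R) -> V -> R).
Hypothesis HL : quad_functional J L.
Implicit Types (x y z : V).
Let L_lin := qf_lin HL.
Let L_ge0 := qf_ge0 HL.
Let L_par := qf_par HL.
Let L_J := qf_J HL.
Let JD := qf_JD HL.
Let JN := qf_JN HL.
Let JJ := qf_JJ HL.

Lemma qf_cst0 x : L (fun=> 0) x = 0.
Proof.
have := L_lin 1 x (tame_cst 0) (tame_cst 0).
under eq_fun do rewrite mulr0 addr0.
rewrite mul1r; lra.
Qed.

Lemma qfZ a f x : tame f -> L (fun t => a * f t) x = a * L f x.
Proof.
move=> tf; have := L_lin a x tf (tame_cst 0).
under eq_fun do rewrite addr0.
by move=> ->; rewrite qf_cst0 addr0.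
Qed.

Lemma qfD f g x : tame f -> tame g -> L (fun t => f t + g t) x = L f x + L g x.
Proof.
move=> tf tg; have := L_lin 1 x tf tg.
under eq_fun do rewrite mul1r.
by rewrite mul1r.
Qed.

Lemma qf_le f g x : tame f -> tame g -> (forall t, f t <= g t) -> L f x <= L g
  x.
Proof.
move=> tf tg fg; have := @L_ge0 (fun t => -1 * f t + g t) x.
rewrite L_lin // mulN1r addrC subr_ge0; apply; first exact: tameZD.
by move=> t; rewrite mulN1r addrC subr_ge0.
Qed.

Lemma qf_norm f g x : tame f -> tame g -> (forall t, `|f t| <= g t) ->
  `|L f x| <= L g x.
Proof.
move=> tf tg fg; rewrite ler_norml; apply/andP; split.
  rewrite -mulN1r -qfZ //; apply: qf_le => //; first exact: tameZ.
  by move=> t; have := fg t; rewrite ler_norml mulN1r => /andP[].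
by apply: qf_le => // t; have := fg t; rewrite ler_norml => /andP[].
Qed.

Section Par.
Variable f : T -> R.
Hypothesis tf : tame f.

Lemma qfx0 : L f 0 = 0.
Proof. by have := L_par 0 0 tf; rewrite subrr addr0; lra. Qed.

Lemma qfxN x : L f (- x) = L f x.
Proof. by have := L_par 0 x tf; rewrite add0r sub0r qfx0; lra. Qed.

(** The polar form of the quadratic form L f. *)
Definition polar x y : R := (L f (x + y) - L f (x - y)) / 4.

Lemma polarC x y : polar x y = polar y x.
Proof. by rewrite /polar [y + x]addrC -[y - x]opprB qfxN. Qed.

Lemma polar0 y : polar 0 y = 0.
Proof. by rewrite /polar add0r sub0r qfxN subrr mul0r. Qed.

Lemma polarxx x : polar x x = L f x.
Proof.
rewrite /polar subrr qfx0; have := L_par x x tf; rewrite subrr qfx0; lra.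
Qed.

(** The theorem of Jordan and von Neumann. *)
Lemma polarDl x y z : polar (x + y) z = polar x z + polar y z.
Proof.
have dbl a b : 2 * (polar a z + polar b z) = polar (a + b) (z + z).
  rewrite /polar.
  have h1 := L_par (a + z) (b + z) tf; have h2 := L_par (a - z) (b - z) tf.
  have e1 : a + z + (b + z) = a + b + (z + z) by rewrite addrACA.
  have e2 : a + z - (b + z) = a - b by rewrite [b + z]addrC addrKA.
  have e3 : a - z + (b - z) = a + b - (z + z) by rewrite addrACA opprD.
  have e4 : a - z - (b - z) = a - b by rewrite opprD opprK addrACA addNr addr0.
  by rewrite e1 e2 in h1; rewrite e3 e4 in h2; lra.
have := dbl (x + y) 0; rewrite polar0 !addr0 -dbl; lra.
Qed.

Lemma polarNl x y : polar (- x) y = - polar x y.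
Proof. by rewrite /polar -opprD qfxN [- x + y]addrC -[y - x]opprB qfxN;
  lra. Qed.

Lemma polarNr x y : polar x (- y) = - polar x y.
Proof. by rewrite polarC polarNl polarC. Qed.

Lemma polarMzl x y k : polar (x *~ k) y = k%:~R * polar x y.
Proof.
have nat_case n : polar (x *+ n) y = n%:R * polar x y.
  elim: n => [|n IH]; first by rewrite mulr0n polar0 mul0r.
  by rewrite mulrSr polarDl IH -natr1 mulrDl mul1r.
case: k => n; first by rewrite -pmulrn nat_case.
by rewrite NegzE mulrNz -pmulrn polarNl nat_case rmorphN /= mulNr.
Qed.

Lemma polar_suml (I : finType) (F : I -> V) y :
  polar (\sum_i F i) y = \sum_i polar (F i) y.
Proof.
by apply: (big_morph (fun x => polar x y)) => [a b|]; rewrite ?polarDl ?polar0.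
Qed.

Lemma polar_sumr (I : finType) (F : I -> V) y :
  polar y (\sum_i F i) = \sum_i polar y (F i).
Proof. by rewrite polarC polar_suml; apply: eq_bigr => i _; rewrite polarC. Qed.

Lemma polarJJ x y : polar (J x) (J y) = polar x y.
Proof.
by rewrite /polar -JN -!JD !L_J.
Qed.

Lemma polarJ_skew x y : polar (J x) y = - polar x (J y).
Proof. by rewrite -polarJJ JJ polarNl. Qed.

Lemma polarxJ x : polar x (J x) = 0.
Proof. by have := polarJ_skew x x; rewrite polarC; lra. Qed.

End Par.

Lemma polarZD a f g x y : tame f -> tame g ->
  polar (fun t => a * f t + g t) x y = a * polar f x y + polar g x y.
Proof. by move=> tf tg; rewrite /polar !L_lin //; lra. Qed.

Lemma polarZ a f x y : tame f -> polar (fun t => a * f t) x y = a * polar f x y.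
Proof. by move=> tf; rewrite /polar !qfZ //; lra. Qed.

Lemma polarD f g x y : tame f -> tame g ->
  polar (fun t => f t + g t) x y = polar f x y + polar g x y.
Proof. by move=> tf tg; rewrite /polar !qfD //; lra. Qed.

Lemma tame_sum (I : Type) (r : seq I) (F : I -> T -> R) : (forall i, tame (F
  i)) ->
  tame (fun t => \sum_(i <- r) F i t).
Proof.
move=> tF; elim: r => [|i r IH].
  by under eq_fun do rewrite big_nil; exact: tame_cst.
by under eq_fun do rewrite big_cons; exact: tameD.
Qed.

Lemma polar_sum (I : Type) (r : seq I) (F : I -> T -> R) x y : (forall i, tame
  (F i)) ->
  polar (fun t => \sum_(i <- r) F i t) x y = \sum_(i <- r) polar (F i) x y.
Proof.
move=> tF; elim: r => [|i r IH].
  by under eq_fun do rewrite big_nil; rewrite big_nil /polar !qf_cst0 subrr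
    mul0r.
under eq_fun do rewrite big_cons.
by rewrite polarD // ?IH ?big_cons //; exact: tame_sum.
Qed.

Lemma polar_le f g x y : tame f -> tame g -> (forall t, `|f t| <= g t) ->
  `|polar f x y| <= (L g x + L g y) / 2.
Proof.
move=> tf tg fg; have h := L_par x y tg.
have := qf_norm (x + y) tf tg fg; have := qf_norm (x - y) tf tg fg.
rewrite /polar normrM normfV [X in _ / X]ger0_norm // => h1 h2.
have := ler_normB (L f (x + y)) (L f (x - y)); lra.
Qed.

Section Positive.
Variables (p : nat) (f : 'I_p -> T -> R) (K : nat).
Hypothesis mf : forall a, measurable_fun setT (f a).
Hypothesis fK : forall a t, `|f a t| <= K%:R.

Lemma tame_prod a b : tame (fun t => f a t * f b t).
Proof.
apply: (@tame_bounded _ (K%:R * K%:R)); first exact: measurable_funM.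
by move=> t; rewrite normrM ler_pM.
Qed.

(** The form (f (x) x, g (x) y) |-> polar (f g) x y is positive semidefinite.
    If the functions take finitely many values, it is the sum over the cells of
    the nonnegative numbers L 1_cell (sum_a v_a xi_a).  Approximating by values
    in (1 / n) Z means that only integer multiples of vectors occur. *)
Lemma polar_psd (xi : 'I_p -> V) :
  0 <= \sum_a \sum_b polar (fun t => f a t * f b t) (xi a) (xi b).
Proof.
(* M bounds the error made when the products f_a f_b are off by one. *)
pose M := \sum_a \sum_b (L (fun=> 1) (xi a) + L (fun=> 1) (xi b)) / 2.
have L10 x : 0 <= L (fun=> 1) x by apply: L_ge0 => //; exact: tame_cst.
have M0 : 0 <= M.
  by rewrite sumr_ge0 // => a _; rewrite sumr_ge0 // => b _;
    rewrite divr_ge0 ?addr_ge0.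
pose S := \sum_a \sum_b polar (fun t => f a t * f b t) (xi a) (xi b).
suff key n : (0 < n)%N -> - S <= M * (2 * K + 1)%:R / n%:R.
  rewrite -oppr_le0; apply/ler_addgt0Pr => e e0; rewrite add0r.
  pose n := (Num.bound (M * (2 * K + 1)%:R / e)).+1.
  apply: (le_trans (key n _)) => //; rewrite ler_pdivrMr ?ltr0n // [e * _]mulrC
    -ler_pdivrMr //.
  rewrite ltW // (lt_le_trans (archi_boundP _)) ?ler_nat //.
  by rewrite divr_ge0 ?(ltW e0) // mulr_ge0.
move=> n0; have n0R : 0 < n%:R :> R by rewrite ltr0n.
have [N [k [v [mk kv]]]] := quantize n0 mf fK.
pose g a t : R := (v (k t a))%:~R / n%:R.
pose e j t : R := \1_(k @^-1` [set j]) t.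
have te j : tame (e j) by exact: tame_indic.
have gE a b : (fun t => g a t * g b t) =
    (fun t => \sum_(j : {ffun 'I_p -> 'I_N}) ((v (j a))%:~R * (v (j b))%:~R /
    n%:R ^+ 2) * e j t).
  apply/funext => t; rewrite (bigD1 (k t)) //= big1 ?addr0.
    rewrite /e indicE mem_set //= mulr1 /g; field; exact: lt0r_neq0.
  move=> j jk; rewrite /e indicE memNset ?mulr0 //= => kj.
  by rewrite kj eqxx in jk.
have tg a b : tame (fun t => g a t * g b t).
  by rewrite gE; apply: tame_sum => j; exact: tameZ.
have gpos : 0 <= \sum_a \sum_b polar (fun t => g a t * g b t) (xi a) (xi b).
  under eq_bigr => a _.
    under eq_bigr => b _.
      rewrite gE polar_sum; last by move=> j; exact: tameZ.
      under eq_bigr => j _ do rewrite polarZ //.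
      over.
    rewrite exchange_big /=.
    over.
  rewrite exchange_big /= sumr_ge0 // => j _.
  have : 0 <= L (e j) (\sum_a xi a *~ v (j a)) / n%:R ^+ 2.
    rewrite divr_ge0 ?exprn_ge0 ?(ltW n0R) //; apply: L_ge0 => // t;
      rewrite /e indicE.
  rewrite -(polarxx (te j)) polar_suml // mulr_suml => h.
  apply: (le_trans h); apply: ler_sum => a _.
  rewrite polarMzl // polar_sumr // mulr_sumr mulr_suml; apply: ler_sum => b _.
  rewrite polarC // polarMzl // polarC //.
  rewrite le_eqVlt; apply/orP; left; apply/eqP; field; exact: lt0r_neq0.
have diff a b : `|polar (fun t => g a t * g b t) (xi a) (xi b) -
      polar (fun t => f a t * f b t) (xi a) (xi b)| <=
    (2 * K + 1)%:R / n%:R * ((L (fun=> 1) (xi a) + L (fun=> 1) (xi b)) / 2).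
  have tfab := tame_prod a b.
  rewrite addrC -mulN1r -polarZD //.
  have tc : tame (fun=> (2 * K + 1)%:R / n%:R * 1) by exact: tame_cst.
  rewrite (le_trans (polar_le (g := fun=> (2 * K + 1)%:R / n%:R * 1) _ _
    (tameZD _ tfab (tg a b)) tc _)) //; last first.
    by rewrite !qfZ //; [lra|exact: tame_cst..].
  move=> t; rewrite mulr1.
  have -> : -1 * (f a t * f b t) + g a t * g b t =
    f a t * (g b t - f b t) + (g a t - f a t) * g b t by ring.
  have h1 : `|g a t - f a t| <= n%:R^-1 by rewrite distrC; exact: kv.
  have h2 : `|g b t - f b t| <= n%:R^-1 by rewrite distrC; exact: kv.
  have nV : n%:R^-1 <= 1 :> R by rewrite invf_le1 // ler1n.
  have h3 : `|g b t| <= K%:R + 1.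
    rewrite -[g b t](subrK (f b t)) (le_trans (ler_normD _ _)) // addrC lerD //.
    exact: le_trans h2 nV.
  rewrite (le_trans (ler_normD _ _)) // (normrM (f a t)) (normrM _ (g b t))
    natrD natrM.
  have := ler_pM (normr_ge0 _) (normr_ge0 _) (fK a t) h2.
  have := ler_pM (normr_ge0 _) (normr_ge0 _) h1 h3.
  set A := _ * `|g b t|; set B := `|f a t| * _; lra.
have : \sum_a \sum_b (polar (fun t => g a t * g b t) (xi a) (xi b) -
      polar (fun t => f a t * f b t) (xi a) (xi b)) <= M * (2 * K + 1)%:R /
        n%:R.
  rewrite /M mulr_suml mulr_suml; apply: ler_sum => a _.
  rewrite mulr_suml mulr_suml; apply: ler_sum => b _.
  rewrite (le_trans (ler_norm _)) // (le_trans (diff a b)) //.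
  by rewrite mulrC mulrA.
under eq_bigr => a _ do rewrite sumrB.
rewrite sumrB -/S => h; lra.
Qed.

End Positive.

(** In this section z = x + i y stands for a coordinate function, and N0 says
    that the formal vector 1 (x) s - z (x) xi has length zero. *)
Section Shift.
Variables (x y : T -> R) (s xi : V).
Hypothesis mx : measurable_fun setT x.
Hypothesis my : measurable_fun setT y.
Hypothesis xyw : forall t, x t ^+ 2 + y t ^+ 2 <= w t.
Hypothesis N0 : L (fun=> 1) s + L (fun t => x t ^+ 2 + y t ^+ 2) xi
  - 2 * polar x s xi - 2 * polar y s (J xi) = 0.

Let coord (z : T -> R) := measurable_fun setT z /\ forall t, z t ^+ 2 <= w t.

Let cx : coord x.
Proof. by split=> // t; rewrite (le_trans _ (xyw t)) // lerDl sqr_ge0. Qed.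

Let cy : coord y.
Proof. by split=> // t; rewrite (le_trans _ (xyw t)) // lerDr sqr_ge0. Qed.

Let coord_le (z : T -> R) (k : nat) t : coord z -> k%:R ^+ 2 <= w t -> k%:R *
  `|z t| <= w t.
Proof.
move=> [_ zw] kw; rewrite -(@ler_pXn2r _ 2) ?nnegrE ?w_ge0 ?mulr_ge0 //.
by rewrite exprMn real_normK ?num_real // [leRHS]expr2 ler_pM ?sqr_ge0.
Qed.

Let coord_tame (z : T -> R) : coord z -> tame z.
Proof.
move=> cz; apply: (@tame_le _ 1); first by case: cz.
by move=> t; have := @coord_le z 1%N t cz; rewrite !mul1r; apply;
  rewrite expr1n.
Qed.

(** The sublevel sets of w, which exhaust the space. *)
Definition wball (k : nat) : set T := [set t | w t <= k%:R ^+ 2].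

Lemma measurable_wball k : measurable (wball k).
Proof.
rewrite (_ : wball k = setT `&` w @^-1` `]-oo, k%:R ^+ 2]); first exact: mw.
by apply/seteqP; split=> t /=; rewrite in_itv /=; [|case].
Qed.

Let chi k : T -> R := \1_(wball k).

Let mchi k : measurable_fun setT (chi k).
Proof. exact/measurable_indic/measurable_wball. Qed.

Let chiE k t : chi k t = if w t <= k%:R ^+ 2 then 1 else 0.
Proof.
rewrite /chi indicE; case: ifPn => [h|/negP h]; first by rewrite mem_set.
by rewrite memNset.
Qed.

(** The coordinates are at most w / k outside wball k, so cutting them off
    there changes the polar forms by O(1 / k). *)
Let tail (z : T -> R) (k : nat) a b : coord z -> (0 < k)%N ->
  `|polar z a b - polar (fun t => z t * chi k t) a b| <= (L w a + L w b) / 2 /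
    k%:R.
Proof.
move=> cz k0; have k0R : 0 < k%:R :> R by rewrite ltr0n.
have tz := coord_tame cz; case: (cz) => mz zw.
have tzc : tame (fun t => z t * chi k t).
  case: tz => _ [C zC]; apply: (@tame_le _ C); first exact: measurable_funM.
  move=> t; rewrite (le_trans _ (zC t)) // normrM chiE.
  case: ifP => _; first by rewrite normr1 mulr1.
  by rewrite normr0 mulr0.
have tk : tame (fun t => k%:R^-1 * w t) by apply: tameZ; exact: tame_w.
rewrite addrC -mulN1r -polarZD //.
rewrite (le_trans (polar_le (g := fun t => k%:R^-1 * w t) _ _ (tameZD _ tzc tz)
  tk _)) //.
  move=> t; rewrite chiE; have [_|kw] := leP (w t) (k%:R ^+ 2).
    by rewrite mulr1 mulN1r addNr normr0 mulr_ge0 ?invr_ge0 ?w_ge0 ?(ltW k0R).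
  by rewrite mulr0 mulr0 add0r mulrC ler_pdivlMr // mulrC coord_le // ltW.
by rewrite !qfZ //; [lra|exact: tame_w..].
Qed.

(** The squared length of chi_k (x) s - z chi_k (x) xi. *)
Let N k := L (chi k) s + L (fun t => (x t ^+ 2 + y t ^+ 2) * chi k t) xi
  - 2 * polar (fun t => x t * chi k t) s xi - 2 * polar (fun t => y t * chi k
    t) s (J xi).

Let tchi k : tame (chi k).
Proof. by apply: tame_indic; exact: measurable_wball. Qed.

Let tsq : tame (fun t => x t ^+ 2 + y t ^+ 2).
Proof.
apply: (@tame_le _ 1); first by apply: measurable_funD; exact: measurable_funX.
by move=> t; rewrite mul1r ger0_norm // addr_ge0 ?sqr_ge0.
Qed.

Let N_le k : (0 < k)%N -> N k <= 2 * (L w s + L w xi) / k%:R.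
Proof.
move=> k0.
have := tail s xi cx k0; have := tail s (J xi) cy k0.
rewrite L_J; last exact: tame_w.
rewrite !ler_norml => /andP[_ h1] /andP[_ h2].
have h3 : L (chi k) s <= L (fun=> 1) s.
  apply: qf_le => //; first exact: tame_cst.
  by move=> t; rewrite chiE; case: ifP.
have h4 : L (fun t => (x t ^+ 2 + y t ^+ 2) * chi k t) xi <=
    L (fun t => x t ^+ 2 + y t ^+ 2) xi.
  have sq0 t : 0 <= x t ^+ 2 + y t ^+ 2 by rewrite addr_ge0 ?sqr_ge0.
  apply: qf_le => //; last by move=> t; rewrite chiE ler_piMr //; case: ifP.
  apply: (@tame_le _ 1); first by apply: measurable_funM => //; case: tsq.
  move=> t; rewrite mul1r chiE ger0_norm; last by rewrite mulr_ge0 //;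
    case: ifP.
  by rewrite (le_trans _ (xyw t)) // ler_piMr //; case: ifP.
rewrite /N; move: N0; lra.
Qed.

(** The shift relation: s may be replaced by z xi in the presence of a bounded
    function of bounded support. *)
Lemma polar_shift f (K n : nat) eta : measurable_fun setT f ->
  (forall t, `|f t| <= K%:R) -> (forall t, ~ wball n t -> f t = 0) ->
  polar f s eta = polar (fun t => x t * f t) xi eta + polar (fun t => y t * f
    t) (J xi) eta.
Proof.
move=> mf fK f0.
pose D := polar f s eta - (polar (fun t => x t * f t) xi eta + polar (fun t =>
  y t * f t) (J xi) eta).
(* An affine function of c that is nonnegative for all c has slope zero. *)
suff Dc c : 0 <= 2 * c * D + L (fun t => f t * f t) eta.
  apply/eqP; rewrite -subr_eq0 -/D; apply/negP => /negP D0.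
  have := Dc (- (L (fun t => f t * f t) eta + 1) / (2 * D)).
  have -> : 2 * (- (L (fun t => f t * f t) eta + 1) / (2 * D)) * D = - (L (fun
    t => f t * f t) eta + 1).
    by field.
  lra.
suff key k : (n < k)%N -> 0 <= c ^+ 2 * N k + (2 * c * D + L (fun t => f t * f
  t) eta).
  rewrite -oppr_le0; apply/ler_addgt0Pr => e e0; rewrite add0r.
  pose M := c ^+ 2 * (2 * (L w s + L w xi)).
  have M0 : 0 <= M.
    have Lw0 a : 0 <= L w a by apply: L_ge0; [exact: tame_w|exact: w_ge0].
    by rewrite mulr_ge0 ?sqr_ge0 // mulr_ge0 // addr_ge0.
  pose k := (maxn n (Num.bound (M / e))).+1.
  have k0 : 0 < k%:R :> R by rewrite ltr0n.
  have nk : (n < k)%N by rewrite ltnS leq_maxl.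
  have := key _ nk; have := ler_wpM2l (sqr_ge0 c) (@N_le k isT).
  have : M / k%:R <= e.
    rewrite ler_pdivrMr // [e * _]mulrC -ler_pdivrMr // ltW //.
    rewrite (lt_le_trans (archi_boundP _)) ?divr_ge0 ?(ltW e0) // ler_nat.
    by rewrite (leq_trans (leq_maxr n _)).
  by rewrite mulrA -/M; lra.
move=> nk.
(* Positivity for the vector c (chi_k (x) s - z chi_k (x) xi) + f (x) eta. *)
pose Fs := [:: (fun t => c * chi k t); (fun t => - c * (x t * chi k t));
               (fun t => - c * (y t * chi k t)); f].
pose F (i : 'I_4) : T -> R := nth f Fs i.
pose X (i : 'I_4) : V := nth eta [:: s; xi; J xi; eta] i.
have mF i : measurable_fun setT (F i).
  rewrite /F; case: i => -[|[|[|[|//]]]] //= _.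
  - by apply: measurable_funM => //; exact: measurable_cst.
  - by apply: measurable_funM; [exact: measurable_cst|exact: measurable_funM].
  - by apply: measurable_funM; [exact: measurable_cst|exact: measurable_funM].
have zb (z : T -> R) t : coord z -> `|z t * chi k t| <= k%:R ^+ 2.
  move=> cz; rewrite chiE normrM; have [wk|_] := leP (w t) (k%:R ^+ 2);
    last first.
    by rewrite normr0 mulr0 exprn_ge0.
  rewrite normr1 mulr1 (le_trans _ wk) //.
  by have := @coord_le z 1%N t cz; rewrite !mul1r; apply; rewrite expr1n.
have [B FB] : exists B : nat, forall i t, `|F i t| <= B%:R.
  exists (maxn K (Num.bound (`|c| * (k%:R ^+ 2 + 1)))) => i t.
  have hB : `|c| * (k%:R ^+ 2 + 1) <= (maxn K (Num.bound (`|c| * (k%:R ^+ 2 +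
    1))))%:R.
    rewrite ltW // (lt_le_trans (archi_boundP _)) ?mulr_ge0 ?addr_ge0
      ?exprn_ge0 //.
    by rewrite ler_nat leq_maxr.
  rewrite /F; case: i => -[|[|[|[|//]]]] //= _.
  - rewrite (le_trans _ hB) // normrM ler_wpM2l // chiE.
    case: ifP => _; first by rewrite normr1 lerDr exprn_ge0.
    by rewrite normr0 addr_ge0 // exprn_ge0.
  - by rewrite (le_trans _ hB) // normrM normrN ler_wpM2l // (le_trans (zb _ _
    cx)) // lerDl.
  - by rewrite (le_trans _ hB) // normrM normrN ler_wpM2l // (le_trans (zb _ _
    cy)) // lerDl.
  - by rewrite (le_trans (fK t)) // ler_nat leq_maxl.
have := polar_psd mF FB X.
have chif t : chi k t * f t = f t.
  rewrite chiE; case: leP => [|kw]; first by rewrite mul1r.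
  rewrite mul0r f0 //; rewrite /wball /= => wn; move: kw; apply/negP;
    rewrite -leNgt.
  rewrite (le_trans wn) // ler_sqr ?nnegrE // ler_nat; exact: ltnW.
have chi2 t : chi k t * chi k t = chi k t.
  by rewrite chiE; case: ifP; rewrite ?mulr1 ?mulr0.
rewrite !big_ord_recl !big_ord0 /F /X /= !addr0.
have PE (g h : T -> R) d a b : (forall t, g t = d * h t) -> tame h ->
    polar g a b = d * polar h a b.
  by move=> gh th; rewrite (_ : g = fun t => d * h t) ?polarZ //; apply/funext.
have tbd (z1 z2 : T -> R) : coord z1 -> coord z2 -> tame (fun t => z1 t * z2 t
  * chi k t).
  move=> c1 c2; apply: (@tame_bounded _ (k%:R ^+ 2 * k%:R ^+ 2)).
    by apply: measurable_funM; [apply: measurable_funM; [case: c1|case: c2]|].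
  by move=> t; rewrite -chi2 mulrACA normrM ler_pM // zb.
have tzc (z : T -> R) : coord z -> tame (fun t => z t * chi k t).
  move=> cz; apply: (@tame_bounded _ (k%:R ^+ 2)); last by move=> t; exact: zb.
  by apply: measurable_funM => //; case: cz.
have tf : tame f by exact: (@tame_bounded _ K%:R).
have tzf (z : T -> R) : coord z -> tame (fun t => z t * f t).
  move=> cz; apply: (@tame_bounded _ (k%:R ^+ 2 * K%:R)).
    by apply: measurable_funM => //; case: cz.
  by move=> t; rewrite -chif mulrA normrM ler_pM // zb.
have tff : tame (fun t => f t * f t).
  by apply: (@tame_bounded _ (K%:R * K%:R)) => [|t];
    [exact: measurable_funM|rewrite normrM ler_pM].
have txc := tzc _ cx; have tyc := tzc _ cy; have txf := tzf _ cx;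
  have tyf := tzf _ cy.
have txx := tbd _ _ cx cx; have tyy := tbd _ _ cy cy; have txy := tbd _ _ cx cy.
rewrite (PE _ (chi k) (c ^+ 2) s s) //; last by move=> t; ring: (chi2 t).
rewrite (PE _ (fun t => x t * chi k t) (- c ^+ 2) s xi) //; last by move=> t;
  ring: (chi2 t) (chif t).
rewrite (PE _ (fun t => y t * chi k t) (- c ^+ 2) s (J xi)) //;
  last by move=> t; ring: (chi2 t) (chif t).
rewrite (PE _ f c s eta) //; last by move=> t; ring: (chi2 t) (chif t).
rewrite (PE _ (fun t => x t * chi k t) (- c ^+ 2) xi s) //; last by move=> t;
  ring: (chi2 t) (chif t).
rewrite (PE _ (fun t => x t * x t * chi k t) (c ^+ 2) xi xi) //;
  last by move=> t; ring: (chi2 t) (chif t).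
rewrite (PE _ (fun t => x t * y t * chi k t) (c ^+ 2) xi (J xi)) //;
  last by move=> t; ring: (chi2 t) (chif t).
rewrite (PE _ (fun t => x t * f t) (- c) xi eta) //; last by move=> t;
  ring: (chi2 t) (chif t).
rewrite (PE _ (fun t => y t * chi k t) (- c ^+ 2) (J xi) s) //;
  last by move=> t; ring: (chi2 t) (chif t).
rewrite (PE _ (fun t => x t * y t * chi k t) (c ^+ 2) (J xi) xi) //;
  last by move=> t; ring: (chi2 t) (chif t).
rewrite (PE _ (fun t => y t * y t * chi k t) (c ^+ 2) (J xi) (J xi)) //;
  last by move=> t; ring: (chi2 t) (chif t).
rewrite (PE _ (fun t => y t * f t) (- c) (J xi) eta) //; last by move=> t;
  ring: (chi2 t) (chif t).
rewrite (PE _ f c eta s) //; last by move=> t; ring: (chi2 t) (chif t).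
rewrite (PE _ (fun t => x t * f t) (- c) eta xi) //; last by move=> t;
  ring: (chi2 t) (chif t).
rewrite (PE _ (fun t => y t * f t) (- c) eta (J xi)) //; last by move=> t;
  ring: (chi2 t) (chif t).
rewrite (polarC txc xi) (polarC tyc (J xi)) (polarC txy (J xi)) polarxJ //
  !polarxx // L_J //.
rewrite (polarC tf eta) (polarC txf eta) (polarC tyf eta).
have -> : N k = L (chi k) s + (L (fun t => x t * x t * chi k t) xi +
    L (fun t => y t * y t * chi k t) xi)
    - 2 * polar (fun t => x t * chi k t) s xi - 2 * polar (fun t => y t * chi k
      t) s (J xi).
  by rewrite /N -qfD //; congr (_ + L _ _ - _ - _); apply/funext => t; ring.
by rewrite /D => h; apply: (le_trans h); rewrite le_eqVlt; apply/orP; left;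
  apply/eqP; ring.
Qed.

End Shift.
End Functional.

(** * Positive functionals dominated by a finite measure *)
Section PositiveFunctional.
Context (R : realType) disp (T : measurableType disp).

(** The bounded measurable functions. *)
Definition bounded_measurable (f : T -> R) :=
  measurable_fun setT f /\ exists C : R, forall t, `|f t| <= C.

(** Linear functionals on them that are nonnegative on nonnegative functions. *)
Definition positive_functional (Phi : (T -> R) -> R) :=
  (forall a f g, bounded_measurable f -> bounded_measurable g ->
    Phi (fun t => a * f t + g t) = a * Phi f + Phi g) /\
  (forall f, bounded_measurable f -> (forall t, 0 <= f t) -> 0 <= Phi f).

Lemma bm_cst c : bounded_measurable (fun=> c).
Proof. by split; [exact: measurable_cst|exists `|c|]. Qed.

Lemma bm_lin a f g : bounded_measurable f -> bounded_measurable g ->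
  bounded_measurable (fun t => a * f t + g t).
Proof.
move=> [mf [C fC]] [mg [D gD]]; split.
  by apply: measurable_funD => //; apply: measurable_funM => //;
    exact: measurable_cst.
exists (`|a| * C + D) => t; rewrite (le_trans (ler_normD _ _)) // lerD //.
by rewrite normrM ler_wpM2l.
Qed.

Lemma bm_indic (A : set T) : measurable A -> bounded_measurable (\1_A).
Proof.
move=> mA; split; first exact: measurable_indic.
by exists 1 => t; rewrite indicE; case: (_ \in _); rewrite ?normr1 ?normr0.
Qed.

Section Phi.
Variable Phi : (T -> R) -> R.
Hypothesis PhiP : positive_functional Phi.

Lemma functional0 : Phi (fun=> 0) = 0.
Proof.
have := PhiP.1 1 _ _ (bm_cst 0) (bm_cst 0).
by under eq_fun do rewrite mulr0 addr0; rewrite mul1r; lra.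
Qed.

Lemma bmZ a f : bounded_measurable f -> bounded_measurable (fun t => a * f t).
Proof.
by move=> bf; have := bm_lin a bf (bm_cst 0); under eq_fun do rewrite addr0.
Qed.

Lemma bmD f g : bounded_measurable f -> bounded_measurable g ->
  bounded_measurable (fun t => f t + g t).
Proof.
by move=> bf bg; have := bm_lin 1 bf bg; under eq_fun do rewrite mul1r.
Qed.

Lemma functionalZ a f : bounded_measurable f -> Phi (fun t => a * f t) = a *
  Phi f.
Proof.
move=> bf; have := PhiP.1 a _ _ bf (bm_cst 0).
by under eq_fun do rewrite addr0; rewrite functional0 addr0.
Qed.

Lemma functionalD f g : bounded_measurable f -> bounded_measurable g ->
  Phi (fun t => f t + g t) = Phi f + Phi g.
Proof.
move=> bf bg; have := PhiP.1 1 _ _ bf bg.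
by under eq_fun do rewrite mul1r; rewrite mul1r.
Qed.

Lemma functional_le f g : bounded_measurable f -> bounded_measurable g ->
  (forall t, f t <= g t) -> Phi f <= Phi g.
Proof.
move=> bf bg fg; rewrite -subr_ge0 -mulN1r addrC -PhiP.1 //.
apply: PhiP.2; first exact: bm_lin.
by move=> t; rewrite mulN1r addrC subr_ge0.
Qed.

Lemma bm_sum (I : Type) (r : seq I) (F : I -> T -> R) :
  (forall i, bounded_measurable (F i)) ->
  bounded_measurable (fun t => \sum_(i <- r) F i t).
Proof.
move=> bF; elim: r => [|i r IH].
  by under eq_fun do rewrite big_nil; exact: bm_cst.
by under eq_fun do rewrite big_cons; exact: bmD.
Qed.

Lemma functional_sum (I : Type) (r : seq I) (F : I -> T -> R) :
  (forall i, bounded_measurable (F i)) ->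
  Phi (fun t => \sum_(i <- r) F i t) = \sum_(i <- r) Phi (F i).
Proof.
move=> bF; elim: r => [|i r IH].
  by under eq_fun do rewrite big_nil; rewrite big_nil functional0.
under eq_fun do rewrite big_cons.
by rewrite functionalD // ?IH ?big_cons //; exact: bm_sum.
Qed.

End Phi.

(** Bounded measurable functions are uniform limits of simple functions. *)
Lemma positive_functional_ext Phi Psi f :
  positive_functional Phi -> positive_functional Psi ->
  (forall A, measurable A -> Phi (\1_A) = Psi (\1_A)) ->
  bounded_measurable f -> Phi f = Psi f.
Proof.
move=> PP QP PQ bf; have [mf [C fC]] := bf.
have c1 : Phi (fun=> 1) = Psi (fun=> 1) by have := PQ _ measurableT;
  rewrite indicT.
pose K := (Num.bound `|C|).
have fK (a : 'I_1) t : `|f t| <= K%:R.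
  by rewrite (le_trans (fC t)) // (le_trans (ler_norm _)) // ltW //
    archi_boundP.
suff key (n : nat) : (0 < n)%N -> `|Phi f - Psi f| <= 2 * Phi (fun=> 1) / n%:R.
  apply/eqP; rewrite -subr_eq0 -normr_le0; apply/ler_addgt0Pr => e e0;
    rewrite add0r.
  have P1 : 0 <= Phi (fun=> 1) by apply: PP.2 => //; exact: bm_cst.
  pose n := (Num.bound (2 * Phi (fun=> 1) / e)).+1.
  apply: (le_trans (key n _)) => //; rewrite ler_pdivrMr ?ltr0n // [e * _]mulrC
    -ler_pdivrMr //.
  rewrite ltW // (lt_le_trans (archi_boundP _)) ?ler_nat //.
  by rewrite divr_ge0 ?(ltW e0) // mulr_ge0.
move=> n0; have n0R : 0 < n%:R :> R by rewrite ltr0n.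
have [N [k [v [mk kv]]]] := quantize n0 (fun _ : 'I_1 => mf) fK.
pose e j : T -> R := \1_(k @^-1` [set j]).
have be j : bounded_measurable (e j) by exact: bm_indic.
pose g t := \sum_(j : {ffun 'I_1 -> 'I_N}) ((v (j ord0))%:~R / n%:R) * e j t.
have bg : bounded_measurable g by apply: bm_sum => j; exact: bmZ.
have gE : Phi g = Psi g.
  rewrite /g !functional_sum //; try by move=> j; exact: bmZ.
  by apply: eq_bigr => j _; rewrite !functionalZ // /e PQ.
have gf t : `|f t - g t| <= n%:R^-1.
  rewrite /g (bigD1 (k t)) //= big1 ?addr0.
    by rewrite /e indicE mem_set //= mulr1; exact: (kv ord0).
  move=> j jk; rewrite /e indicE memNset ?mulr0 //= => kj.
  by rewrite kj eqxx in jk.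
have bc : bounded_measurable (fun t => n%:R^-1 * 1) by exact: bm_cst.
have appr X : positive_functional X -> `|X f - X g| <= X (fun=> 1) / n%:R.
  move=> PX; have bfg : bounded_measurable (fun t => -1 * g t + f t) by exact:
    bm_lin.
  have := functional_le PX bfg bc; rewrite PX.1 // functionalZ //;
    last exact: bm_cst.
  have bfg' : bounded_measurable (fun t => -1 * f t + g t) by exact: bm_lin.
  have := functional_le PX bfg' bc; rewrite PX.1 // functionalZ //;
    last exact: bm_cst.
  rewrite !mulN1r => h1 h2; rewrite ler_norml; apply/andP; split.
    have : - X f + X g <= n%:R^-1 * X (fun=> 1).
      apply: h1 => t; have := gf t; rewrite ler_norml => /andP[]; lra.
    lra.
  have : - X g + X f <= n%:R^-1 * X (fun=> 1).
    apply: h2 => t; have := gf t; rewrite ler_norml => /andP[]; lra.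
  lra.
have h1 := appr _ PP; have h2 := appr _ QP.
rewrite -c1 in h2; rewrite gE in h1.
have -> : Phi f - Psi f = (Phi f - Psi g) - (Psi f - Psi g) by ring.
by rewrite (le_trans (ler_normB _ _)) //; lra.
Qed.

(** Finite additivity and domination by a finite measure give countable
    additivity: the remainders of a disjoint union have sigma-measure tending
    to zero. *)
Lemma dominated_measure (Phi : (T -> R) -> R) (sigma : {measure set T -> \bar
  R}) :
  positive_functional Phi -> (sigma setT < +oo)%E ->
  (forall A, measurable A -> ((Phi (\1_A))%:E <= sigma A)%E) ->
  exists nu : {measure set T -> \bar R},
    forall A, measurable A -> nu A = (Phi (\1_A))%:E.
Proof.
move=> PP sfin dom.
(* The absolute value makes nu0 nonnegative on nonmeasurable sets as well. *)
pose nu0 (A : set T) : \bar R := (`|Phi (\1_A)|)%:E.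
have nuE A : measurable A -> nu0 A = (Phi (\1_A))%:E.
  move=> mA; rewrite /nu0 ger0_norm //; apply: PP.2; first exact: bm_indic.
  by move=> t; rewrite indicE.
have nu00 : nu0 set0 = 0%E by rewrite /nu0 indic0 (functional0 PP) normr0.
have nu_ge0 A : (0 <= nu0 A)%E by rewrite lee_fin.
have nu_sigma : semi_sigma_additive nu0.
  move=> F mF tF mUF.
  pose Rn n := \bigcup_(i in [set i | (n <= i)%N]) F i.
  have mR n : measurable (Rn n) by exact: bigcup_measurable.
  have step n : Phi (\1_(Rn n)) = Phi (\1_(F n)) + Phi (\1_(Rn n.+1)).
    rewrite -(functionalD PP) //; try exact: bm_indic.
    congr Phi; apply/funext => t; rewrite !indicE.
    have [Fnt|Fnt] := pselect (F n t).
      have Rnt : Rn n t by exists n => /=.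
      rewrite (mem_set Fnt) (mem_set Rnt) memNset ?addr0 // => -[m /= nm Fmt].
      have := tF n m I I (ex_intro _ t (conj Fnt Fmt)) => nE.
      by rewrite nE ltnn in nm.
    rewrite (memNset Fnt) add0r; congr (nat_of_bool _)%:R.
    apply/idP/idP; rewrite !inE => -[m /= nm Fmt]; exists m => //=;
      last exact: ltnW.
    rewrite ltn_neqAle nm andbT; apply/eqP => nE.
    by rewrite nE in Fnt.
  have R0 : Rn 0%N = \bigcup_i F i.
    by apply/seteqP; split => t [m _ Fmt]; exists m.
  have split n : \sum_(0 <= i < n) Phi (\1_(F i)) = Phi (\1_(\bigcup_i F i)) -
    Phi (\1_(Rn n)).
    elim: n => [|n IH]; first by rewrite big_geq // R0 subrr.
    by rewrite big_nat_recr //= IH (step n); ring.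
  have Rcvg : Phi (\1_(Rn n)) @[n --> \oo] --> (0 : R).
    have sR : sigma \o Rn @ \oo --> sigma (\bigcap_n Rn n).
      apply: nonincreasing_cvg_mu => //.
      - by rewrite (le_lt_trans _ sfin) // le_measure ?inE.
      - exact: bigcapT_measurable.
      - move=> m n mn; apply/subsetPset => t [i /= ni Fit]; exists i => //=.
        exact: leq_trans ni.
    have cap0 : \bigcap_n Rn n = set0.
      rewrite -subset0 => t h; have [i _ Fit] := h 0%N I.
      have [j /= ij Fjt] := h i.+1 I.
      have := tF i j I I (ex_intro _ t (conj Fit Fjt)) => ijE.
      by rewrite ijE ltnn in ij.
    rewrite cap0 measure0 in sR.
    suff /fine_cvgP[] : (Phi (\1_(Rn n)))%:E @[n --> \oo] --> 0%:E by [].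
    apply: (squeeze_cvge _ (cvg_cst 0%E) sR).
    near=> n; rewrite /= dom // andbT lee_fin; apply: PP.2;
      first exact: bm_indic.
    by move=> t; rewrite indicE.
  rewrite (_ : (fun n => _) = (fun n => (Phi (\1_(\bigcup_i F i)) - Phi (\1_(Rn
    n)))%:E)); last first.
    apply/funext => n; rewrite -split -sumEFin; apply: eq_bigr => i _;
      exact: nuE.
  rewrite nuE //; apply: cvg_EFin; first by near=> n.
  rewrite -[X in _ --> X]subr0; apply: cvgB => //; exact: cvg_cst.
pose nuM := isMeasure.Build disp T R nu0 nu00 nu_ge0 nu_sigma.
pose nu : {measure set T -> \bar R} := HB.pack nu0 nuM.
by exists nu.
Unshelve. all: by end_near.
Qed.

Lemma bounded_integrable (nu : {measure set T -> \bar R}) f :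
  (nu setT < +oo)%E -> bounded_measurable f -> nu.-integrable setT (EFin \o f).
Proof.
move=> nufin [mf [C fC]]; apply: measurable_bounded_integrable => //.
exists C; split; first exact: num_real.
by move=> M CM t _ /=; rewrite (le_trans (fC t)) // ltW.
Qed.

Lemma Rintegral_positive_functional (nu : {measure set T -> \bar R}) :
  (nu setT < +oo)%E -> positive_functional (fun f => Rintegral nu setT f).
Proof.
move=> nufin; split.
  move=> a f g bf bg; rewrite RintegralD //; try exact: bounded_integrable.
    rewrite RintegralZl //; exact: bounded_integrable.
  by apply: bounded_integrable => //; exact: bmZ.
by move=> f bf f0; apply: Rintegral_ge0 => t _.
Qed.

Lemma dominated_representation (Phi : (T -> R) -> R) (sigma : {measure set T ->
  \bar R}) :
  positive_functional Phi -> (sigma setT < +oo)%E ->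
  (forall A, measurable A -> ((Phi (\1_A))%:E <= sigma A)%E) ->
  exists nu : {measure set T -> \bar R}, (nu setT < +oo)%E /\
    forall f, bounded_measurable f -> Rintegral nu setT f = Phi f.
Proof.
move=> PP sfin dom; have [nu nuE] := dominated_measure PP sfin dom.
have nufin : (nu setT < +oo)%E by rewrite nuE // ltry.
exists nu; split=> // f bf.
apply: (positive_functional_ext (Rintegral_positive_functional nufin) PP) => //.
move=> A mA; rewrite /Rintegral integral_indic // setIT.
by have := nuE _ mA => ->.
Qed.

End PositiveFunctional.

(** * The sesquilinear forms attached to c *)
Section ComplexParts.
Context (R : realType).
Implicit Types x y : R[i].

(** The imaginary unit. *)
Definition imag : R[i] := Complex 0 1.

Lemma Re_add x y : complex.Re (x + y) = complex.Re x + complex.Re y.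
Proof. by case: x => ? ?; case: y. Qed.
Lemma Im_add x y : complex.Im (x + y) = complex.Im x + complex.Im y.
Proof. by case: x => ? ?; case: y. Qed.
Lemma Re_opp x : complex.Re (- x) = - complex.Re x.
Proof. by case: x. Qed.
Lemma Im_opp x : complex.Im (- x) = - complex.Im x.
Proof. by case: x. Qed.
Lemma Re_mul x y : complex.Re (x * y) =
  complex.Re x * complex.Re y - complex.Im x * complex.Im y.
Proof. by case: x => ? ?; case: y. Qed.
Lemma Im_mul x y : complex.Im (x * y) =
  complex.Re x * complex.Im y + complex.Im x * complex.Re y.
Proof. by case: x => ? ?; case: y. Qed.
Lemma Re_conjc x : complex.Re (Num.conj x) = complex.Re x.
Proof. by case: x. Qed.
Lemma Im_conjc x : complex.Im (Num.conj x) = - complex.Im x.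
Proof. by case: x. Qed.
Lemma imag2 : imag * imag = -1.
Proof. by apply/eqP; rewrite eq_complex /= !mul0r !mulr0 !mulr1 ?addr0 ?add0r
  ?oppr0 ?eqxx. Qed.
Lemma conj_imag : Num.conj imag = - imag.
Proof. by apply/eqP; rewrite eq_complex /= oppr0 !eqxx. Qed.
Lemma invnatC m : (m%:R : R[i])^-1 = Complex (m%:R^-1 : R) 0.
Proof. by rewrite -(rmorph_nat (real_complex R)) -fmorphV. Qed.
Definition ReImE := (Re_add, Im_add, Re_opp, Im_opp, Re_mul, Im_mul, Re_conjc,
  Im_conjc).
End ComplexParts.

Section Sesquilinear.
Context (R : realType) (d : nat).
Variable c : mindex d -> mindex d -> R[i].
Implicit Types (xi eta : Xi R d) (m n k l : mindex d).

(** The sesquilinear form whose value at (xi, xi) is cxi c xi m n. *)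
Definition cform m n xi eta : R[i] :=
  mmap idfun (fun k => mmap (@Num.conj R[i]) (fun l => c (m + k) (n + l)) eta)
    xi.

Lemma cxiE xi m n : cxi c xi m n = cform m n xi xi.
Proof.
rewrite /cxi /cform mmapE; apply: eq_bigr => k _; rewrite mmapE mulr_sumr.
by apply: eq_bigr => l _ /=; rewrite -mulrA mulrC -mulrA.
Qed.

Lemma cformDl m n x y z : cform m n (x + y) z = cform m n x z + cform m n y z.
Proof. by rewrite /cform mmapD. Qed.

Lemma cformDr m n x y z : cform m n x (y + z) = cform m n x y + cform m n x z.
Proof.
rewrite /cform !mmapE -big_split; apply: eq_bigr => k _ /=.
by rewrite mmapD mulrDr.
Qed.

Lemma cformZl m n a x y : cform m n (a *: x) y = a * cform m n x y.
Proof.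
rewrite /cform (mmapEw (msuppZ_le _ _)) mmapE mulr_sumr.
by apply: eq_bigr => k _ /=; rewrite mcoeffZ mulrA.
Qed.

Lemma cformZr m n a x y : cform m n x (a *: y) = Num.conj a * cform m n x y.
Proof.
rewrite /cform !mmapE mulr_sumr; apply: eq_bigr => k _ /=.
rewrite (mmapEw (msuppZ_le _ _)) mmapE mulrCA; congr (_ * _).
by rewrite mulr_sumr; apply: eq_bigr => l _ /=; rewrite mcoeffZ rmorphM mulrA.
Qed.

Lemma cformNl m n x y : cform m n (- x) y = - cform m n x y.
Proof. by rewrite -scaleN1r cformZl mulN1r. Qed.

Lemma cformNr m n x y : cform m n x (- y) = - cform m n x y.
Proof. by rewrite -scaleN1r cformZr rmorphN rmorph1 mulN1r. Qed.

(** The sequence with the single entry 1, at k. *)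
Definition delta k : Xi R d := << (1 : R[i]) *g k >>%R.

Lemma cform_delta m n k l : cform m n (delta k) (delta l) = c (m + k) (n + l).
Proof. by rewrite /cform /delta !mmapU /= rmorph1 !mul1r. Qed.

(** Multiplication by the imaginary unit. *)
Definition imul xi : Xi R d := imag R *: xi.

Lemma imulD x y : imul (x + y) = imul x + imul y.
Proof. exact: scalerDr. Qed.
Lemma imulN x : imul (- x) = - imul x.
Proof. exact: scalerN. Qed.
Lemma imulK x : imul (imul x) = - x.
Proof. by rewrite /imul scalerA imag2 scaleN1r. Qed.

Lemma cform_imul m n x y : cform m n (imul x) (imul y) = cform m n x y.
Proof. by rewrite /imul cformZl cformZr conj_imag mulrA mulrN imag2 opprK
  mul1r. Qed.

Lemma cform_scale m n (p : nat) x :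
  cform m n (p%:R^-1 *: x) (p%:R^-1 *: x) = (p%:R^-1) ^+ 2 * cform m n x x.
Proof. by rewrite cformZl cformZr fmorphV rmorph_nat mulrA expr2. Qed.

End Sesquilinear.

Section Monomials.
Context (R : realType) (d : nat).
Implicit Types (m n : mindex d) (z : cspace R d).

(** The multi-index of length one supported at j. *)
Definition munit (j : 'I_d) : mindex d := [ffun i => (i == j) : nat].

Lemma mlen_munit j : mlen (munit j) = 1%N.
Proof.
rewrite /mlen (bigD1 j) //= big1 ?addn0; first by rewrite ffunE eqxx.
by move=> i /negPf ij; rewrite ffunE ij.
Qed.

Lemma mlen0 : mlen (0 : mindex d) = 0%N.
Proof. by rewrite /mlen big1 // => i _; rewrite ffunE. Qed.

Lemma zmonom0 z : zmonom 0 z = 1.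
Proof. by rewrite /zmonom big1 // => i _; rewrite ffunE expr0. Qed.

Lemma zmonomD m n z : zmonom (m + n) z = zmonom m z * zmonom n z.
Proof. by rewrite /zmonom -big_split; apply: eq_bigr => i _;
  rewrite ffunE exprD. Qed.

Lemma zmonom_munit j z : zmonom (munit j) z = z ord0 j.
Proof.
rewrite /zmonom (bigD1 j) //= big1 ?mulr1; first by rewrite ffunE eqxx expr1.
by move=> i /negPf ij; rewrite ffunE ij expr0.
Qed.

Lemma zbarmonomE n z : zbarmonom n z = Num.conj (zmonom n z).
Proof. by rewrite /zbarmonom /zmonom rmorph_prod; apply: eq_bigr => i _;
  rewrite rmorphXn. Qed.

(** Induction on multi-indices, one unit at a time. *)
Lemma mindex_ind (P : mindex d -> Prop) :
  P 0 -> (forall m j, P m -> P (m + munit j)) -> forall m, P m.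
Proof.
move=> P0 PS m; have [s] := ubnP (mlen m); elim: s m => // s IH m ms.
have [->//|m0] := eqVneq m 0.
have [j mj] : exists j, (0 < m j)%N.
  apply/existsP; apply: contra_neqT m0; rewrite negb_exists => /forallP h.
  by apply/ffunP => j; rewrite ffunE; have := h j; rewrite lt0n negbK => /eqP.
pose m' : mindex d := [ffun i => (m i - (i == j))%N].
have mE : m = m' + munit j.
  apply/ffunP => i; rewrite !ffunE natrDE subnK //.
  by case: eqP => // ->.
rewrite mE; apply: PS; apply: IH; move: ms; rewrite ltnS; apply: leq_trans.
rewrite [in mlen m]mE.
have -> : mlen (m' + munit j) = (mlen m' + 1)%N.
  by rewrite -(mlen_munit j) /mlen -big_split; apply: eq_bigr => i _;
    rewrite ffunE.
by rewrite addn1.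
Qed.

End Monomials.

(** * From a convex family of measures to quadratic functionals *)
Lemma fin_convex (R : realType) (a b e : R) :
  (0 <= a%:E + b%:E - 2%:E * e%:E)%E -> 2 * e <= a + b.
Proof. rewrite -EFinM -EFinN -!EFinD lee_fin; lra. Qed.

Lemma parallelogram_avg (R : realType) (a1 a2 a3 a4 b1 b2 b3 b4 : R) :
  a1 + a2 = 2 * (a3 + a4) -> b1 + b2 = 2 * (b3 + b4) ->
  (a1 + b1) / 2 + (a2 + b2) / 2 = 2 * ((a3 + b3) / 2 + (a4 + b4) / 2).
Proof. by move=> ? ?; lra. Qed.

Section FromFamily.
Context (R : realType) (d : nat) (c : mindex d -> mindex d -> R[i]).
Context disp (T : measurableType disp) (z : T -> cspace R d).
Variable mu : Xi R d -> {measure set T -> \bar R}.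
Hypothesis mu_moments : forall (xi : Xi R d) (m n : mindex d),
  (mlen m <= 1)%N -> (mlen n <= 1)%N ->
  has_cintegral (mu xi) (fun t => zmonom m (z t) * zbarmonom n (z t)) (cxi c xi
    m n).
Hypothesis mu_convex : forall (xi eta : Xi R d) (A : set T), measurable A ->
  (0 <= mu (xi + eta)%R A + mu (xi - eta)%R A - 2%:E * mu eta A)%E.
Implicit Types (xi eta : Xi R d) (f g : T -> R).

(** The real and imaginary parts of the coordinates. *)
Definition cRe j t : R := complex.Re (z t ord0 j).
Definition cIm j t : R := complex.Im (z t ord0 j).
(** The function 1 + |z|^2, whose integrals are prescribed. *)
Definition weight t : R := 1 + \sum_(j < d) (cRe j t ^+ 2 + cIm j t ^+ 2).
(** The integral of f as a function of xi. *)
Definition integ f xi : R := Rintegral (mu xi) setT f.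

Let moment00 xi : [/\ (mu xi).-integrable setT (EFin \o (fun=> 1 : R)),
  integ (fun=> 1) xi = complex.Re (cform c 0 0 xi xi) &
  complex.Im (cform c 0 0 xi xi) = 0].
Proof.
have := @mu_moments xi 0 0; rewrite mlen0 cxiE => /(_ isT isT).
rewrite (_ : (fun t => _) = fun=> 1); last first.
  by apply/funext => t; rewrite zbarmonomE !zmonom0 rmorph1 mulr1.
by move=> [i1 _ ->]; split => //=; rewrite Rintegral_cst // mul0r.
Qed.

Let moment10 j xi : [/\ (mu xi).-integrable setT (EFin \o cRe j),
  (mu xi).-integrable setT (EFin \o cIm j),
  integ (cRe j) xi = complex.Re (cform c (munit j) 0 xi xi) &
  integ (cIm j) xi = complex.Im (cform c (munit j) 0 xi xi)].
Proof.
have := @mu_moments xi (munit j) 0; rewrite mlen0 mlen_munit cxiE => /(_ isT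
  isT).
rewrite (_ : (fun t => _) = fun t => z t ord0 j); last first.
  by apply/funext => t; rewrite zbarmonomE zmonom0 zmonom_munit rmorph1 mulr1.
by move=> [i1 i2 ->]; split.
Qed.

Let moment11 j xi :
  (mu xi).-integrable setT (EFin \o (fun t => cRe j t ^+ 2 + cIm j t ^+ 2)) /\
  integ (fun t => cRe j t ^+ 2 + cIm j t ^+ 2) xi =
    complex.Re (cform c (munit j) (munit j) xi xi).
Proof.
have := @mu_moments xi (munit j) (munit j);
  rewrite mlen_munit cxiE => /(_ isT isT) [].
have E : (fun t => complex.Re (zmonom (munit j) (z t) * zbarmonom (munit j) (z
  t))) =
    (fun t => cRe j t ^+ 2 + cIm j t ^+ 2).
  by apply/funext => t; rewrite zbarmonomE zmonom_munit !ReImE /cRe /cIm; ring.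
by rewrite E => i1 _ ->.
Qed.

Let mRe j : measurable_fun setT (cRe j).
Proof. by have [/measurable_int /measurable_EFinP] := moment10 j 0. Qed.

Let mIm j : measurable_fun setT (cIm j).
Proof. by have [_ /measurable_int /measurable_EFinP] := moment10 j 0. Qed.

Let sq_ge0 j t : 0 <= cRe j t ^+ 2 + cIm j t ^+ 2.
Proof. by rewrite addr_ge0 ?sqr_ge0. Qed.

Let weight_ge1 t : 1 <= weight t.
Proof. by rewrite lerDl sumr_ge0. Qed.

Let weight_coord j t : cRe j t ^+ 2 + cIm j t ^+ 2 <= weight t.
Proof. by rewrite /weight (bigD1 j) //= addrCA lerDl addr_ge0 // sumr_ge0. Qed.

Let mweight : measurable_fun setT weight.
Proof.
apply: measurable_funD; first exact: measurable_cst.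
rewrite (_ : (fun _ => _) = (fun t => \sum_(j <- enum 'I_d) (cRe j t ^+ 2 + cIm
  j t ^+ 2))); last first.
  by apply/funext => t; rewrite big_enum.
apply: measurable_sum => j.
by apply: measurable_funD; exact: measurable_funX.
Qed.

Let weight_integrable xi : (mu xi).-integrable setT (EFin \o weight).
Proof.
rewrite (_ : _ \o _ = (EFin \o (fun=> 1 : R)) \+
   (fun t => \sum_(j < d) ((cRe j t ^+ 2 + cIm j t ^+ 2)%R)%:E)%E); last first.
  by apply/funext => t; rewrite /= EFinD -sumEFin.
apply: integrableD => //; first by case: (moment00 xi).
by apply: integrable_sum => // j _; case: (moment11 j xi).
Qed.

Notation tame := (tame weight).

Let tame_integrable f xi : tame f -> (mu xi).-integrable setT (EFin \o f).
Proof.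
move=> [mf [C fC]].
apply: (@le_integrable _ _ _ (mu xi) setT measurableT (EFin \o f) (fun t =>
  `|C|%:E * (EFin \o weight) t)%E).
- exact/measurable_EFinP.
- move=> t _ /=; rewrite lee_fin (le_trans (fC t)) // normrM normr_id.
  have w0 : 0 <= weight t by rewrite (le_trans ler01).
  by rewrite (ger0_norm w0) ler_wpM2r // ler_norm.
- exact: integrableZl.
Qed.

Let integ_lin a f g : tame f -> tame g ->
  integ (fun t => a * f t + g t) = (fun xi => a * integ f xi + integ g xi).
Proof.
move=> tf tg; apply/funext => xi; rewrite /integ RintegralD //.
- by rewrite RintegralZl //; exact: tame_integrable.
- by apply: tame_integrable; exact: (tameZ weight_ge1).
- exact: tame_integrable.
Qed.

Let integ_ge0 f xi : (forall t, 0 <= f t) -> 0 <= integ f xi.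
Proof. by move=> f0; apply: Rintegral_ge0 => t _. Qed.

Let mu_finite xi A : measurable A -> mu xi A = (integ (\1_A) xi)%:E.
Proof.
move=> mA; rewrite /integ /Rintegral integral_indic // setIT fineK //.
have muT : (mu xi setT < +oo)%E.
  case: (moment00 xi) => /integrableP[_ /=] + _ _.
  by under eq_integral do rewrite normr1; rewrite integral_cst // mul1e.
by rewrite ge0_fin_numE // (le_lt_trans _ muT) // le_measure // inE.
Qed.

(** The inequality at (0, eta) and at (0, - eta). *)
Let mu_even xi A : measurable A -> mu (- xi) A = mu xi A.
Proof.
move=> mA.
have le eta : (mu eta A <= mu (- eta)%R A)%E.
  have := @mu_convex 0 eta A mA; rewrite add0r sub0r !mu_finite // =>
    /fin_convex; rewrite lee_fin; lra.
by apply/eqP; rewrite eq_le le andbT -{2}(opprK xi) le.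
Qed.

(** The inequality at (u, x) has base point u, but u - x and x - u define the
    same measure. *)
Let integ_convex f u x : tame f -> (forall t, 0 <= f t) -> 0 <= sdiff (integ f)
  u x.
Proof.
move=> tf f0; have [mf _] := tf.
have mfE : measurable_fun setT (EFin \o f) by exact/measurable_EFinP.
have fE t : (0 <= (EFin \o f) t)%E by rewrite lee_fin.
have le A : measurable A ->
    (measure_add (mu x) (mu x) A <= measure_add (mu (x + u)) (mu (x - u)) A)%E.
  move=> mA; rewrite !measure_addE; have := @mu_convex u x A mA.
  rewrite -[u - x]opprB mu_even // [u + x]addrC !mu_finite // => /fin_convex.
  rewrite -!EFinD lee_fin; lra.
have := ge0_le_measure_integral le measurableT fE mfE.
rewrite !ge0_integral_measure_add //.
have E xi : (\int[mu xi]_x (EFin \o f) x)%E = (integ f xi)%:E.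
  by rewrite /integ /Rintegral fineK //; apply: integrable_fin_num => //;
    exact: tame_integrable.
rewrite !E -!EFinD lee_fin /sdiff; lra.
Qed.

Lemma cform_quadratic (m n : mindex d) :
  [/\ forall u x, sdiff (fun xi => complex.Re (cform c m n xi xi)) u x =
        2 * complex.Re (cform c m n u u),
      forall u x, sdiff (fun xi => complex.Im (cform c m n xi xi)) u x =
        2 * complex.Im (cform c m n u u),
      forall p x, (0 < p)%N ->
        complex.Re (cform c m n (p%:R^-1 *: x) (p%:R^-1 *: x)) =
          complex.Re (cform c m n x x) / p%:R ^+ 2 &
      forall p x, (0 < p)%N ->
        complex.Im (cform c m n (p%:R^-1 *: x) (p%:R^-1 *: x)) =
          complex.Im (cform c m n x x) / p%:R ^+ 2].
Proof.
split.
- by move=> u x; rewrite /sdiff !(cformDl, cformDr, cformNl, cformNr, ReImE);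
  lra.
- by move=> u x; rewrite /sdiff !(cformDl, cformDr, cformNl, cformNr, ReImE);
  lra.
- move=> p x p0; rewrite cform_scale invnatC !expr2  !Re_mul !Im_mul /=.
  by field; rewrite pnatr_eq0 -lt0n.
- move=> p x p0; rewrite cform_scale invnatC !expr2 !Im_mul !Re_mul /=.
  by field; rewrite pnatr_eq0 -lt0n.
Qed.

Let W := integ weight.

Let WE xi : W xi = complex.Re (cform c 0 0 xi xi) +
  \sum_(j < d) complex.Re (cform c (munit j) (munit j) xi xi).
Proof.
have tsq j : tame (fun t => cRe j t ^+ 2 + cIm j t ^+ 2).
  apply: (@tame_le _ _ _ _ _ 1); first by apply: measurable_funD;
    exact: measurable_funX.
  by move=> t; rewrite ger0_norm // mul1r.
have step (r : seq 'I_d) : integ (fun t => 1 + \sum_(j <- r) (cRe j t ^+ 2 +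
  cIm j t ^+ 2)) xi =
   complex.Re (cform c 0 0 xi xi) + \sum_(j <- r) complex.Re (cform c (munit j)
     (munit j) xi xi).
  elim: r => [|j r IH].
    under [in LHS]eq_fun do rewrite big_nil addr0.
    by rewrite big_nil addr0; case: (moment00 xi).
  under [in LHS]eq_fun do rewrite big_cons addrCA -[X in X + _]mul1r.
  rewrite integ_lin //; last first.
    apply: tameD; first exact: (tame_cst weight_ge1).
    exact: (tame_sum weight_ge1).
  by rewrite IH big_cons mul1r addrCA; case: (moment11 j xi) => _ ->.
exact: step.
Qed.

Let W_ge0 xi : 0 <= W xi.
Proof. by apply: integ_ge0 => t; rewrite (le_trans ler01). Qed.

Let W_sdiff u x : sdiff W u x = 2 * W u.
Proof.
have h m n := let: And4 h _ _ _ := cform_quadratic m n in h.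
rewrite /sdiff !WE.
have -> : forall a b e (A B C : 'I_d -> R), a + \sum_(j < d) A j + (b + \sum_(j
  < d) B j) -
   2 * (e + \sum_(j < d) C j) = (a + b - 2 * e) + \sum_(j < d) (A j + B j - 2 *
     C j).
  move=> a b e A B C; rewrite sumrB big_split -mulr_sumr /=; ring.
have := h 0 0 u x; rewrite {1}/sdiff => ->.
rewrite mulrDr mulr_sumr; congr (_ + _); apply: eq_bigr => j _; exact: h.
Qed.

Let W_scale p x : (0 < p)%N -> W (p%:R^-1 *: x) = W x / p%:R ^+ 2.
Proof.
move=> p0; have h m n := let: And4 _ _ h _ := cform_quadratic m n in h p x p0.
by rewrite !WE h mulrDl mulr_suml; congr (_ + _); apply: eq_bigr.
Qed.

(** Convexity for C w + f and for C w - f. *)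
Let integ_bounded f : tame f -> exists C, sdiff_bounded W C (integ f).
Proof.
move=> tf; have [_ [C fC]] := tf; exists (2 * C) => u x.
have tw : tame weight by exact: (tame_w weight_ge1 mweight).
have tCw : tame (fun t => C * weight t) by exact: (tameZ weight_ge1).
have EC : integ (fun t => C * weight t) = (fun xi => C * W xi).
  have := integ_lin C tw (tame_cst weight_ge1 0).
  under [X in integ X = _]eq_fun do rewrite addr0.
  move=> ->; apply/funext => xi; rewrite /integ Rintegral_cst // mul0r;
    exact: addr0.
have h1 := @integ_convex (fun t => 1 * f t + C * weight t) u x.
have h2 := @integ_convex (fun t => -1 * f t + C * weight t) u x.
rewrite !integ_lin // !EC in h1 h2.
have {}h1 := h1 (tameZD 1 tf tCw).
have {}h2 := h2 (tameZD (-1) tf tCw).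
have lo t : 0 <= 1 * f t + C * weight t by have := fC t;
  rewrite ler_norml => /andP[]; lra.
have up t : 0 <= -1 * f t + C * weight t by have := fC t;
  rewrite ler_norml => /andP[]; lra.
move: (h1 lo) (h2 up); have := W_sdiff u x; rewrite /sdiff => h.
by rewrite ler_norml => ? ?; apply/andP; split; nra.
Qed.

(** The mean is taken with the hat functions in the directions delta 0 and
    i delta 0; since L f (delta 0) is the average of its values at these two
    vectors, it is dominated by the four corner measures. *)
Lemma exists_functional : exists L : (T -> R) -> Xi R d -> R,
  [/\ quad_functional weight (@imul R d) L,
    forall xi, L (fun=> 1) xi = complex.Re (cform c 0 0 xi xi),
    forall j xi, L (cRe j) xi = complex.Re (cform c (munit j) 0 xi xi) /\
      L (cIm j) xi = complex.Im (cform c (munit j) 0 xi xi),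
    forall j xi, L (fun t => cRe j t ^+ 2 + cIm j t ^+ 2) xi =
      complex.Re (cform c (munit j) (munit j) xi xi) &
    exists nu : {measure set T -> \bar R}, (nu setT < +oo)%E /\
      forall f, bounded_measurable f -> Rintegral nu setT f = L f (delta R 0)].
Proof.
pose u1 : Xi R d := delta R 0; pose u2 := imul u1.
have [Lam [Lam_lin Lam_ge0 Lam_par Lam_quad Lam_corners]] :=
  quadratic_mean u1 u2 W_ge0 W_scale.
pose L f xi : R := (Lam (integ f) xi + Lam (integ f) (imul xi)) / 2.
have LamN f xi : tame f -> Lam (integ f) (- xi) = Lam (integ f) xi.
  move=> /integ_bounded [C bC].
  have h0 := Lam_par _ _ 0 0 bC; have := Lam_par _ _ 0 xi bC.
  by move: h0; rewrite subrr addr0 add0r sub0r; lra.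
have LP : quad_functional weight (@imul R d) L.
  split.
  - move=> a f g xi tf tg; rewrite /L integ_lin //.
    have [C bC] := integ_bounded tf; have [D bD] := integ_bounded tg.
    by rewrite !(Lam_lin _ _ _ _ _ _ bC bD); lra.
  - move=> f xi tf f0; have [C bC] := integ_bounded tf.
    have h x := Lam_ge0 _ _ x bC (fun u y => integ_convex u y tf f0).
    by rewrite /L divr_ge0 // addr_ge0.
  - move=> f x y tf; have [C bC] := integ_bounded tf.
    have h1 := Lam_par _ _ x y bC; have h2 := Lam_par _ _ (imul x) (imul y) bC.
    have e1 : imul (x + y) = imul x + imul y by exact: imulD.
    have e2 : imul (x - y) = imul x - imul y by rewrite -imulN; exact: imulD.
    by rewrite /L e1 e2; apply: parallelogram_avg; [exact: h1|exact: h2].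
  - by move=> f x tf; rewrite /L imulK LamN //; lra.
  - exact: imulD.
  - exact: imulN.
  - exact: imulK.
have cform_imul_xi m n xi : cform c m n (imul xi) (imul xi) = cform c m n xi xi
  by exact: cform_imul.
have LRe m n f : (forall xi, integ f xi = complex.Re (cform c m n xi xi)) ->
    forall xi, L f xi = complex.Re (cform c m n xi xi).
  move=> /funext fE xi; have [h1 _ h3 _] := cform_quadratic m n.
  rewrite /L fE !Lam_quad //=.
    by rewrite cform_imul_xi; lra.
  - by move=> p p0; exact: h3.
  - by move=> p p0; exact: h3.
have LIm m n f : (forall xi, integ f xi = complex.Im (cform c m n xi xi)) ->
    forall xi, L f xi = complex.Im (cform c m n xi xi).
  move=> /funext fE xi; have [_ h1 _ h3] := cform_quadratic m n.
  rewrite /L fE !Lam_quad //=.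
    by rewrite cform_imul_xi; lra.
  - by move=> p p0; exact: h3.
  - by move=> p p0; exact: h3.
exists L; split=> //.
- by apply: LRe => xi; case: (moment00 xi).
- by move=> j xi; split; [apply: LRe|apply: LIm] => {}xi; case: (moment10 j xi).
- by move=> j; apply: LRe => xi; case: (moment11 j xi).
have bm_tame f : bounded_measurable f -> tame f.
  by move=> [mf [C fC]]; exact: (tame_bounded weight_ge1 mf fC).
pose sigma : {measure set T -> \bar R} :=
  measure_add (measure_add (mu (u1 + u2)) (mu (u1 - u2)))
              (measure_add (mu (- u1 + u2)) (mu (- u1 - u2))).
have sigmaE A : measurable A -> sigma A = (corners u1 u2 (integ (\1_A)))%:E.
  move=> mA; rewrite /sigma [LHS]measure_addE.
  rewrite [X in (X + _)%E]measure_addE [X in (_ + X)%E]measure_addE.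
  by rewrite !mu_finite // /corners -!EFinD !addrA.
apply: (@dominated_representation _ _ _ _ sigma).
- split; first by move=> a f g /bm_tame tf /bm_tame tg; exact: (qf_lin LP).
  by move=> f /bm_tame tf f0; exact: (qf_ge0 LP).
- by rewrite sigmaE // ltry.
move=> A mA; rewrite sigmaE // lee_fin.
have tA : tame (\1_A) by apply: bm_tame; exact: bm_indic.
have A0 t : 0 <= (\1_A t : R) by rewrite indicE.
have [C bC] := integ_bounded tA.
have cvx u y := integ_convex u y tA A0.
have iA0 y : 0 <= integ (\1_A) y by exact: integ_ge0.
have iAW y : integ (\1_A) y <= 1 * W y.
  have A1 t : (\1_A t : R) <= weight t.
    by apply: le_trans (weight_ge1 t); rewrite indicE; case: (_ \in _).
  by rewrite mul1r; exact: (le_Rintegral measurableT (tame_integrable y tA)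
    (weight_integrable y) (fun t _ => A1 t)).
have h1 := Lam_corners _ _ _ u1 bC cvx iA0 iAW ler01 (mem_head _ _).
have h2 := Lam_corners _ _ _ u2 bC cvx iA0 iAW ler01 (mem_last _ [:: u2]).
have : 0 <= corners u1 u2 (integ (\1_A)) by rewrite /corners !addr_ge0.
by rewrite /L; lra.
Qed.

Lemma measurable_coord j : measurable_fun setT (cRe j) /\ measurable_fun setT
  (cIm j).
Proof. by []. Qed.

Lemma weight_ge_coord j t : cRe j t ^+ 2 + cIm j t ^+ 2 <= weight t.
Proof. exact: weight_coord. Qed.

Lemma weight_facts : (forall t, 1 <= weight t) /\ measurable_fun setT weight.
Proof. by []. Qed.

Lemma cform00_real xi : complex.Im (cform c 0 0 xi xi) = 0.
Proof. by case: (moment00 xi). Qed.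

End FromFamily.

(** * Moments of the representing measure *)
Section Representation.
Context (R : realType) (d : nat) (c : mindex d -> mindex d -> R[i]).
Context disp (T : measurableType disp) (z : T -> cspace R d).
Variable L : (T -> R) -> Xi R d -> R.
Local Notation w := (weight z).
Local Notation x := (cRe z).
Local Notation y := (cIm z).
Local Notation delta := (@delta R d).
Hypothesis mxy : forall j, measurable_fun setT (x j) /\ measurable_fun setT (y
  j).
Hypothesis w1 : forall t, 1 <= w t.
Hypothesis mw : measurable_fun setT w.
Hypothesis xyw : forall j t, x j t ^+ 2 + y j t ^+ 2 <= w t.
Hypothesis HL : quad_functional w (@imul R d) L.
Hypothesis L1 : forall xi, L (fun=> 1) xi = complex.Re (cform c 0 0 xi xi).
Hypothesis Lxy : forall j xi, L (x j) xi = complex.Re (cform c (munit j) 0 xi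
  xi) /\
  L (y j) xi = complex.Im (cform c (munit j) 0 xi xi).
Hypothesis Lsq : forall j xi, L (fun t => x j t ^+ 2 + y j t ^+ 2) xi =
  complex.Re (cform c (munit j) (munit j) xi xi).
Hypothesis c_real : forall xi, complex.Im (cform c 0 0 xi xi) = 0.
Implicit Types (xi eta : Xi R d) (k m n : mindex d) (G : T -> R[i]).
Local Notation polarL := (polar L).
Local Notation tame := (tame w).

Let polar_one xi eta : polarL (fun=> 1) xi eta =
  (complex.Re (cform c 0 0 xi eta) + complex.Re (cform c 0 0 eta xi)) / 2.
Proof.
by rewrite /polar !L1 !(cformDl, cformDr, cformNl, cformNr, ReImE); lra.
Qed.

Let polar_re j xi eta : polarL (x j) xi eta =
  (complex.Re (cform c (munit j) 0 xi eta) + complex.Re (cform c (munit j) 0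
  eta xi)) / 2.
Proof.
rewrite /polar; have [-> _] := Lxy j (xi + eta);
  have [-> _] := Lxy j (xi - eta).
by rewrite !(cformDl, cformDr, cformNl, cformNr, ReImE); lra.
Qed.

Let polar_im j xi eta : polarL (y j) xi eta =
  (complex.Im (cform c (munit j) 0 xi eta) + complex.Im (cform c (munit j) 0
  eta xi)) / 2.
Proof.
rewrite /polar; have [_ ->] := Lxy j (xi + eta);
  have [_ ->] := Lxy j (xi - eta).
by rewrite !(cformDl, cformDr, cformNl, cformNr, ReImE); lra.
Qed.

(** The formal vector 1 (x) delta_(k + e_j) - z_j (x) delta_k has length zero. *)
Let shift_defect k j :
  L (fun=> 1) (delta (k + munit j)) + L (fun t => x j t ^+ 2 + y j t ^+ 2)
    (delta k)
  - 2 * polarL (x j) (delta (k + munit j)) (delta k)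
  - 2 * polarL (y j) (delta (k + munit j)) (imul (delta k)) = 0.
Proof.
rewrite L1 Lsq polar_re polar_im /imul !(cformZl, cformZr) !cform_delta !add0r.
rewrite conj_imag !ReImE /= [munit j + k]addrC; lra.
Qed.

(** Bounded measurable complex functions vanishing outside some wball n. *)
Definition bounded_support G := exists K n : nat,
  [/\ measurable_fun setT (fun t => complex.Re (G t)),
      measurable_fun setT (fun t => complex.Im (G t)),
      forall t, `|complex.Re (G t)| <= K%:R /\ `|complex.Im (G t)| <= K%:R &
      forall t, ~ wball w n t -> G t = 0].

Let bs_coord j G : bounded_support G -> bounded_support (fun t => z t ord0 j *
  G t).
Proof.
move=> [K [n [mR mI GK G0]]]; have [mx my] := mxy j.
have zn t : wball w n t -> `|x j t| <= n%:R /\ `|y j t| <= n%:R.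
  rewrite /wball /= => wn; have h := le_trans (xyw j t) wn.
  split; rewrite -(@ler_pXn2r _ 2) ?nnegrE // real_normK ?num_real //.
    by have := sqr_ge0 (y j t); lra.
  by have := sqr_ge0 (x j t); lra.
exists (2 * n * K)%N, n; split.
- under eq_fun do rewrite Re_mul; apply: measurable_funB;
  exact: measurable_funM.
- under eq_fun do rewrite Im_mul; apply: measurable_funD;
  exact: measurable_funM.
- move=> t; have [tn|/G0 ->] := pselect (wball w n t);
  last by rewrite mulr0 /= normr0.
  have [hx hy] := zn t tn; have [hR hI] := GK t.
  rewrite Re_mul Im_mul -/(x j t) -/(y j t) !natrM; split.
    rewrite (le_trans (ler_normB _ _)) // !normrM.
    have := ler_pM (normr_ge0 _) (normr_ge0 _) hx hR.
    have := ler_pM (normr_ge0 _) (normr_ge0 _) hy hI; lra.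
  rewrite (le_trans (ler_normD _ _)) // !normrM.
  have := ler_pM (normr_ge0 _) (normr_ge0 _) hx hI.
  have := ler_pM (normr_ge0 _) (normr_ge0 _) hy hR; lra.
- by move=> t /G0 ->; rewrite mulr0.
Qed.

Let bs_conj G : bounded_support G -> bounded_support (fun t => Num.conj (G t)).
Proof.
move=> [K [n [mR mI GK G0]]]; exists K, n; split.
- by under eq_fun do rewrite Re_conjc.
- under eq_fun do rewrite Im_conjc; exact: measurable_funN.
- by move=> t; rewrite Re_conjc Im_conjc normrN.
- by move=> t /G0 ->; rewrite rmorph0.
Qed.

Let bs_tame G : bounded_support G ->
  tame (fun t => complex.Re (G t)) /\ tame (fun t => complex.Im (G t)).
Proof.
move=> [K [n [mR mI GK _]]]; split; apply: (tame_bounded w1 (C := K%:R)) => //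
  t;
by case: (GK t).
Qed.

(** The complex sesquilinear form attached to G: the value at (xi, eta) of the
    sesquilinear extension of L, applied to G. *)
Definition beta G xi eta : R[i] :=
  Complex (polarL (fun t => complex.Re (G t)) xi eta - polarL (fun t =>
    complex.Im (G t)) xi (imul eta))
          (polarL (fun t => complex.Re (G t)) xi (imul eta) + polarL (fun t =>
          complex.Im (G t)) xi eta).

Let skew := @polarJ_skew R disp T w (Xi R d) (@imul R d) L HL.

Let beta_conj G xi eta : bounded_support G ->
  beta G eta xi = Num.conj (beta (fun t => Num.conj (G t)) xi eta).
Proof.
move=> bG; have [tR tI] := bs_tame bG; have [tR' tI'] := bs_tame (bs_conj bG).
have -> : beta (fun t => Num.conj (G t)) xi eta =
  Complex (polarL (fun t => complex.Re (G t)) xi eta + polarL (fun t =>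
    complex.Im (G t)) xi (imul eta))
          (polarL (fun t => complex.Re (G t)) xi (imul eta) - polarL (fun t =>
          complex.Im (G t)) xi eta).
  rewrite /beta; have E u v : polarL (fun t => complex.Im (Num.conj (G t))) u v
    =
      - polarL (fun t => complex.Im (G t)) u v.
    rewrite -mulN1r -(polarZ w1 HL) //; congr (polarL _ u v).
    by apply/funext => t; rewrite Im_conjc mulN1r.
  have F : (fun t => complex.Re (Num.conj (G t))) = (fun t => complex.Re (G t)).
    by apply/funext => t; rewrite Re_conjc.
  by rewrite !E !F opprK.
have S f : tame f -> polarL f eta (imul xi) = - polarL f xi (imul eta).
  by move=> tf; rewrite (polarC HL tf) skew.
apply/eqP; rewrite eq_complex Re_conjc Im_conjc /= !S //.
rewrite (polarC HL tR eta) (polarC HL tI eta).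
by apply/andP; split; apply/eqP; lra.
Qed.

Let beta_shift G k j eta : bounded_support G ->
  beta G (delta (k + munit j)) eta = beta (fun t => z t ord0 j * G t) (delta k)
    eta.
Proof.
move=> bG; have [tR tI] := bs_tame bG; case: (bG) => K [n [mR mI GK G0]].
have [mx my] := mxy j.
have shR e := polar_shift w1 mw HL mx my (xyw j) (shift_defect k j) e mR (fun t
  => (GK t).1)
  (fun t h => congr1 (@complex.Re R) (G0 t h)).
have shI e := polar_shift w1 mw HL mx my (xyw j) (shift_defect k j) e mI (fun t
  => (GK t).2)
  (fun t h => congr1 (@complex.Im R) (G0 t h)).
have prod_tame (u v : T -> R) : measurable_fun setT u -> (forall t, u t ^+ 2 <=
  w t) ->
    measurable_fun setT v -> (forall t, `|v t| <= K%:R) -> tame (fun t => u t *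
      v t).
  move=> mu uw mv vK; apply: (@tame_le _ _ _ _ _ K%:R);
    first exact: measurable_funM.
  move=> t; rewrite normrM mulrC ler_pM //.
  rewrite -(@ler_pXn2r _ 2) ?nnegrE //; last by rewrite (le_trans ler01).
  by rewrite real_normK ?num_real // (le_trans (uw t)) // expr2 ler_peMr //
    (le_trans ler01).
have xw t : x j t ^+ 2 <= w t by rewrite (le_trans _ (xyw j t)) // lerDl
  sqr_ge0.
have yw t : y j t ^+ 2 <= w t by rewrite (le_trans _ (xyw j t)) // lerDr
  sqr_ge0.
have txR := prod_tame _ _ mx xw mR (fun t => (GK t).1).
have txI := prod_tame _ _ mx xw mI (fun t => (GK t).2).
have tyR := prod_tame _ _ my yw mR (fun t => (GK t).1).
have tyI := prod_tame _ _ my yw mI (fun t => (GK t).2).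
have ER u v : polarL (fun t => complex.Re (z t ord0 j * G t)) u v =
    polarL (fun t => x j t * complex.Re (G t)) u v - polarL (fun t => y j t *
      complex.Im (G t)) u v.
  rewrite addrC -mulN1r -(polarZD HL) //; congr (polar L _ u v);
    apply/funext => t.
  by rewrite Re_mul mulN1r addrC.
have EI u v : polarL (fun t => complex.Im (z t ord0 j * G t)) u v =
    polarL (fun t => x j t * complex.Im (G t)) u v + polarL (fun t => y j t *
      complex.Re (G t)) u v.
  rewrite -(polarD HL) //; congr (polar L _ u v); apply/funext => t.
  by rewrite Im_mul.
rewrite /beta !ER !EI !shR !shI !skew // !imulK.
rewrite !(polarNr HL) //.
by apply/eqP; rewrite eq_complex /=; apply/andP; split; apply/eqP; lra.
Qed.

(** Multiplication by the monomial z^m. *)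
Let zmul m G t : R[i] := zmonom m (z t) * G t.

Let bs_zmul m G : bounded_support G -> bounded_support (zmul m G).
Proof.
move=> bG; elim/mindex_ind: m => [|m j IH].
  by rewrite (_ : zmul 0 G = G) //; apply/funext => t;
    rewrite /zmul zmonom0 mul1r.
rewrite (_ : zmul _ G = fun t => z t ord0 j * zmul m G t);
  first exact: bs_coord.
by apply/funext => t; rewrite /zmul zmonomD zmonom_munit mulrAC mulrC mulrA.
Qed.

Let beta_zmul m G eta : bounded_support G ->
  beta G (delta m) eta = beta (zmul m G) (delta 0) eta.
Proof.
elim/mindex_ind: m G => [|m j IH] G bG.
  congr (beta _ _ _); apply/funext => t; rewrite /zmul zmonom0 mul1r //.
rewrite beta_shift // IH; last exact: bs_coord.
congr (beta _ _ _); apply/funext => t.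
by rewrite /zmul zmonomD zmonom_munit mulrA.
Qed.

(** The shift relation, iterated in both arguments. *)
Lemma beta_delta m n G : bounded_support G ->
  beta G (delta m) (delta n) =
    beta (fun t => zmonom m (z t) * zbarmonom n (z t) * G t) (delta 0) (delta
      0).
Proof.
move=> bG; rewrite beta_zmul // beta_conj; last exact: bs_zmul.
rewrite beta_zmul; last by apply: bs_conj; exact: bs_zmul.
have FE : (fun t => zmonom m (z t) * zbarmonom n (z t) * G t) =
    (fun t => Num.conj (zmul n (fun t => Num.conj (zmul m G t)) t)).
  apply/funext => t; rewrite /zmul zbarmonomE !rmorphM /= !conjCK; ring.
have bc : bounded_support (zmul n (fun t => Num.conj (zmul m G t))).
  by apply: bs_zmul; apply: bs_conj; exact: bs_zmul.
rewrite FE [RHS]beta_conj; last exact: bs_conj.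
congr (Num.conj (beta _ _ _)); apply/funext => t; rewrite conjCK //.
Qed.

Lemma beta_diag G xi : bounded_support G ->
  beta G xi xi = Complex (L (fun t => complex.Re (G t)) xi) (L (fun t =>
    complex.Im (G t)) xi).
Proof.
move=> bG; have [tR tI] := bs_tame bG.
by rewrite /beta !(polarxJ HL) // !(polarxx HL) // subr0 add0r.
Qed.

(** The indicator of wball r, as a complex function. *)
Let chi r t : R[i] := if w t <= r%:R ^+ 2 then 1 else 0.

Let bs_chi r : bounded_support (chi r).
Proof.
have ReE : (fun t => complex.Re (chi r t)) = \1_(wball w r).
  apply/funext => t; rewrite indicE /chi; case: ifPn => [h|/negP h];
    first by rewrite mem_set.
  by rewrite memNset.
have ImE : (fun t => complex.Im (chi r t)) = fun=> 0.
  by apply/funext => t; rewrite /chi; case: ifP.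
exists 1%N, r; split.
- by rewrite ReE; apply: measurable_indic; exact: measurable_wball.
- by rewrite ImE; exact: measurable_cst.
- by move=> t; rewrite /chi; case: ifP => _ /=; rewrite ?normr1 ?normr0.
- by move=> t h; rewrite /chi ifN //; apply/negP.
Qed.

Let beta_chi r xi eta : beta (chi r) xi eta =
  Complex (polarL (fun t => complex.Re (chi r t)) xi eta) (polarL (fun t =>
    complex.Re (chi r t)) xi (imul eta)).
Proof.
have I0 u v : polarL (fun t => complex.Im (chi r t)) u v = 0.
  have -> : (fun t => complex.Im (chi r t)) = fun t => 0 * (fun=> 1) t.
    by apply/funext => t; rewrite mul0r /chi; case: ifP.
  by rewrite (polarZ w1 HL) ?mul0r //; exact: tame_cst.
by rewrite /beta !I0 subr0 addr0.
Qed.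

(** A sesquilinear form that is real on the diagonal is Hermitian. *)
Let cform_herm xi eta : cform c 0 0 eta xi = Num.conj (cform c 0 0 xi eta).
Proof.
have h1 := c_real (xi + eta); have h2 := c_real (xi + imul eta).
have hx := c_real xi; have he := c_real eta; have hr := c_real (imul eta).
move: h1 h2; rewrite !(cformDl, cformDr) !Im_add hx he hr => h1.
rewrite /imul !(cformZl, cformZr) conj_imag !ReImE /= => h2.
by apply/eqP; rewrite eq_complex Re_conjc Im_conjc; apply/andP; split;
  apply/eqP; lra.
Qed.

Let polar_one_form xi eta :
  Complex (polarL (fun=> 1) xi eta) (polarL (fun=> 1) xi (imul eta)) = cform c
    0 0 xi eta.
Proof.
rewrite !polar_one /imul !(cformZl, cformZr) (cform_herm xi eta) conj_imag
  !ReImE /=.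
by apply/eqP; rewrite eq_complex /=; apply/andP; split; apply/eqP; lra.
Qed.

Let polar_chi_cvg xi eta :
  polarL (fun t => complex.Re (chi r t)) xi eta @[r --> \oo] --> polarL (fun=>
    1) xi eta.
Proof.
pose M := (L w xi + L w eta) / 2.
have tw : tame w by exact: tame_w.
have M0 : 0 <= M.
  by rewrite divr_ge0 // addr_ge0 //; apply: (qf_ge0 HL) => // t;
    rewrite (le_trans ler01).
have bnd r : `|polarL (fun t => complex.Re (chi r.+1 t)) xi eta - polarL (fun=>
  1) xi eta| <= M / r.+1%:R.
  have t1 : tame (fun=> 1) by exact: tame_cst.
  have [tc _] := bs_tame (bs_chi r.+1).
  rewrite addrC -mulN1r -(polarZD HL) //.
  have tk : tame (fun t => r.+1%:R^-1 * w t) by exact: tameZ.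
  rewrite (le_trans (polar_le w1 HL (g := fun t => r.+1%:R^-1 * w t) _ _
    (tameZD _ t1 tc) tk _)) //.
    move=> t; rewrite /chi mulr1; case: ifPn => /= [_|].
      by rewrite addNr normr0 mulr_ge0 ?invr_ge0 // (le_trans ler01).
    rewrite -ltNge => h; rewrite addr0 normrN1 mulrC ler_pdivlMr ?ltr0n //
      mul1r.
    rewrite (le_trans _ (ltW h)) // expr2 ler_peMr // ler1n //.
  by rewrite !(qfZ w1 HL) // /M -mulrDr [_ * (_ + _)]mulrC mulrAC.
apply/cvgrPdist_le => e e0; near=> r.
have [r' rE] : exists r', r = r'.+1.
  exists r.-1; rewrite prednK //; near: r; exact: nbhs_infty_gt.
rewrite distrC rE (le_trans (bnd _)) // -rE ler_pdivrMr;
  last by rewrite rE ltr0n.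
rewrite mulrC -ler_pdivrMr //; near: r; apply: nbhs_infty_ger.
Unshelve. all: by end_near.
Qed.

Variable nu : {measure set T -> \bar R}.
Hypothesis nu_fin : (nu setT < +oo)%E.
Hypothesis nuE : forall f : T -> R, bounded_measurable f -> Rintegral nu setT f
  = L f (delta 0).

Let P m n t := zmonom m (z t) * zbarmonom n (z t).

Let bs_Pchi m n r : bounded_support (fun t => P m n t * chi r t).
Proof.
rewrite (_ : (fun t => _) =
    fun t => Num.conj (zmul n (fun t => Num.conj (zmul m (chi r) t)) t)).
  by apply: bs_conj; apply: bs_zmul; apply: bs_conj; exact: bs_zmul.
by apply/funext => t; rewrite /zmul /P zbarmonomE !rmorphM /= !conjCK; ring.
Qed.

Lemma truncated_moment m n r :
  Complex (Rintegral nu setT (fun t => complex.Re (P m n t * chi r t)))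
          (Rintegral nu setT (fun t => complex.Im (P m n t * chi r t))) =
  Complex (polarL (fun t => complex.Re (chi r t)) (delta m) (delta n))
          (polarL (fun t => complex.Re (chi r t)) (delta m) (imul (delta n))).
Proof.
rewrite -beta_chi beta_delta //.
rewrite beta_diag; last exact: bs_Pchi.
case: (bs_Pchi m n r) => K [k [mR mI PK _]].
by rewrite !nuE //; split => //; exists K%:R => t; case: (PK t).
Qed.

Let measurable_zmonom m :
  measurable_fun setT (fun t => complex.Re (zmonom m (z t))) /\
  measurable_fun setT (fun t => complex.Im (zmonom m (z t))).
Proof.
elim/mindex_ind: m => [|m j [IR II]].
  split; under eq_fun do rewrite zmonom0; exact: measurable_cst.
have [mx my] := mxy j.
split; under eq_fun do rewrite zmonomD zmonom_munit ?Re_mul ?Im_mul.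
  exact: (measurable_funB (measurable_funM IR mx) (measurable_funM II my)).
exact: (measurable_funD (measurable_funM IR my) (measurable_funM II mx)).
Qed.

(** The function |z^m|^2. *)
Let sqmod m t : R := complex.Re (zmonom m (z t)) ^+ 2 + complex.Im (zmonom m (z
  t)) ^+ 2.

Let measurable_P m n :
  measurable_fun setT (fun t => complex.Re (P m n t)) /\
  measurable_fun setT (fun t => complex.Im (P m n t)).
Proof.
have [am bm] := measurable_zmonom m; have [an bn] := measurable_zmonom n.
split; under eq_fun do rewrite /P zbarmonomE ?Re_mul ?Im_mul Re_conjc Im_conjc.
  apply: measurable_funB; first exact: measurable_funM.
  by apply: measurable_funM => //; exact: measurable_funN.
apply: measurable_funD; last exact: measurable_funM.
by apply: measurable_funM => //; exact: measurable_funN.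
Qed.

Let sqmodE m t : sqmod m t = complex.Re (P m m t).
Proof. by rewrite /sqmod /P zbarmonomE Re_mul Re_conjc Im_conjc; ring. Qed.

Let sqmod_ge0 m t : 0 <= sqmod m t.
Proof. by rewrite addr_ge0 ?sqr_ge0. Qed.

Let P_le m n t : `|complex.Re (P m n t)| <= sqmod m t + sqmod n t /\
  `|complex.Im (P m n t)| <= sqmod m t + sqmod n t.
Proof.
rewrite /P zbarmonomE Re_mul Im_mul Re_conjc Im_conjc /sqmod.
set a := complex.Re _; set b := complex.Im _; set u := complex.Re _;
  set v := complex.Im _.
split; rewrite ler_norml; apply/andP; split.
- by have := sqr_ge0 (a + u); have := sqr_ge0 (b + v); have := sqr_ge0 a;
  have := sqr_ge0 b; have := sqr_ge0 u; have := sqr_ge0 v; lra.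
- by have := sqr_ge0 (a - u); have := sqr_ge0 (b - v); have := sqr_ge0 a;
  have := sqr_ge0 b; have := sqr_ge0 u; have := sqr_ge0 v; lra.
- by have := sqr_ge0 (a - v); have := sqr_ge0 (b + u); have := sqr_ge0 a;
  have := sqr_ge0 b; have := sqr_ge0 u; have := sqr_ge0 v; lra.
- by have := sqr_ge0 (a + v); have := sqr_ge0 (b - u); have := sqr_ge0 a;
  have := sqr_ge0 b; have := sqr_ge0 u; have := sqr_ge0 v; lra.
Qed.

Let chi_near t : \forall r \near \oo, chi r t = 1.
Proof.
near=> r; rewrite /chi ifT //.
have h : w t <= r%:R by near: r; exact: nbhs_infty_ger.
rewrite (le_trans h) // expr2 ler_peMr // (le_trans _ h) //.
Unshelve. all: by end_near. Qed.

Let ReIm_chi (g : R[i]) r t : complex.Re (g * chi r t) = complex.Re g *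
  complex.Re (chi r t) /\
  complex.Im (g * chi r t) = complex.Im g * complex.Re (chi r t).
Proof. by rewrite Re_mul Im_mul /chi; case: ifP => /=;
  rewrite !mulr0 subr0 add0r. Qed.

Let chi01 r t : 0 <= complex.Re (chi r t) <= 1.
Proof. by rewrite /chi; case: ifP => /=; rewrite ?lexx ler01. Qed.

Let measurable_chi r : measurable_fun setT (fun t => complex.Re (chi r t)).
Proof. by case: (bs_chi r) => K [n []]. Qed.

Let cut_integrable m n r :
  nu.-integrable setT (EFin \o (fun t => complex.Re (P m n t * chi r t))) /\
  nu.-integrable setT (EFin \o (fun t => complex.Im (P m n t * chi r t))).
Proof.
case: (bs_Pchi m n r) => K [k [mR mI PK _]].
by split; apply: bounded_integrable => //; split => //; exists K%:R => t;
  case: (PK t).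
Qed.

(** By monotone convergence, since the truncated integrals converge. *)
Let sqmod_integrable m : nu.-integrable setT (EFin \o sqmod m).
Proof.
have [mR _] := measurable_P m m.
have mS : measurable_fun setT (EFin \o sqmod m).
  apply/measurable_EFinP; rewrite (_ : sqmod m = fun t => complex.Re (P m m t))
    //.
  by apply/funext => t; rewrite sqmodE.
apply/integrableP; split => //.
have -> : (\int[nu]_t `|(EFin \o sqmod m) t| = \int[nu]_t (EFin \o sqmod m)
  t)%E.
  by apply: eq_integral => t _; rewrite gee0_abs // lee_fin.
pose g r t : \bar R := (sqmod m t * complex.Re (chi r t))%:E.
have gE r t : g r t = (complex.Re (P m m t * chi r t))%:E.
  by rewrite /g sqmodE; have [-> _] := ReIm_chi (P m m t) r t.
have mg r : measurable_fun setT (g r).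
  apply/measurable_EFinP; apply: measurable_funM => //; exact/measurable_EFinP.
have g0 r t : setT t -> (0 <= g r t)%E.
  by move=> _; rewrite lee_fin mulr_ge0 //; case/andP: (chi01 r t).
have ndg t : setT t -> nondecreasing_seq (g ^~ t).
  move=> _ r s rs; rewrite lee_fin ler_wpM2l // /chi.
  case: ifP => [h|_]; last by case: ifP => /=; rewrite ?ler01.
  by rewrite ifT // (le_trans h) // ler_sqr ?nnegrE // ler_nat.
have lim t : limn (g ^~ t) = (sqmod m t)%:E.
  apply/cvg_lim => //; apply: cvg_near_cst.
  near=> r; rewrite /g (_ : chi r t = 1) /= ?mulr1 //.
  by near: r; exact: chi_near.
have := @cvg_monotone_convergence _ _ _ nu setT measurableT g mg g0 ndg.
under [X in _ --> X -> _]eq_integral do rewrite lim.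
move=> h.
have h2 : (\int[nu]_t g r t)%E @[r --> \oo] --> (polarL (fun=> 1) (delta m)
  (delta m))%:E.
  apply: cvg_EFin.
    near=> r; apply: integrable_fin_num => //.
    rewrite (_ : g r = EFin \o (fun t => complex.Re (P m m t * chi r t))).
      exact: (cut_integrable m m r).1.
    by apply/funext => t; rewrite gE.
  rewrite (_ : _ \o _ = fun r => polarL (fun t => complex.Re (chi r t)) (delta
    m) (delta m)); last first.
    apply/funext => r /=; have [<- _] := truncated_moment m m r.
    by congr fine; apply: eq_integral => t _; rewrite gE.
  exact: polar_chi_cvg.
by rewrite (cvg_unique _ h h2) // ltry.
Unshelve. all: by end_near. Qed.

Lemma functional_moment m n :
  has_cintegral nu (fun t => zmonom m (z t) * zbarmonom n (z t)) (c m n).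
Proof.
have iS : nu.-integrable setT (fun t => (EFin \o sqmod m) t + (EFin \o sqmod n)
  t)%E.
  exact: integrableD.
have [mR mI] := measurable_P m n.
have main (p : R[i] -> R) (q : T -> R) : (forall t, q t = p (P m n t)) ->
    measurable_fun setT q -> (forall t, `|q t| <= sqmod m t + sqmod n t) ->
    nu.-integrable setT (EFin \o q) /\
    Rintegral nu setT (fun t => q t * complex.Re (chi r t)) @[r --> \oo] -->
      Rintegral nu setT q.
  move=> qE mq qS.
  have iq : nu.-integrable setT (EFin \o q).
    apply: le_integrable iS => //; first exact/measurable_EFinP.
    move=> t _; rewrite /= lee_fin [leRHS]ger0_norm ?addr_ge0 ?sqr_ge0 //;
      exact: qS.
  split => //; apply: fine_cvg.
  rewrite fineK; last exact: integrable_fin_num.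
  have mq_ r : measurable_fun setT (fun t => (q t * complex.Re (chi r t))%:E).
    by apply/measurable_EFinP; exact: measurable_funM.
  have mqE : measurable_fun setT (EFin \o q) by exact/measurable_EFinP.
  have cvgq : {ae nu, forall t, setT t ->
      (q t * complex.Re (chi r t))%:E @[r --> \oo] --> (EFin \o q) t}.
    apply: aeW => t _; apply: cvg_near_cst; near=> r.
    rewrite (_ : chi r t = 1) /= ?mulr1 //.
    by near: r; exact: chi_near.
  have dom : {ae nu, forall t r, setT t ->
      (`|(q t * complex.Re (chi r t))%:E| <= (EFin \o sqmod m) t + (EFin \o
      sqmod n) t)%E}.
    apply: aeW => t r _; rewrite /= lee_fin normrM (le_trans _ (qS t)) //.
    have /andP[h0 h1] := chi01 r t; by rewrite (ger0_norm h0) ler_piMr.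
  by case: (dominated_convergence measurableT mq_ mqE cvgq iS dom).
have [iR cR] := main (@complex.Re R) _ (fun=> erefl) mR (fun t => (P_le m n
  t).1).
have [iI cI] := main (@complex.Im R) _ (fun=> erefl) mI (fun t => (P_le m n
  t).2).
split => //.
have tm r := truncated_moment m n r.
have fR : (fun r => Rintegral nu setT (fun t => complex.Re (P m n t) *
  complex.Re (chi r t))) =
    (fun r => polarL (fun t => complex.Re (chi r t)) (delta m) (delta n)).
  apply/funext => r; have [<- _] := tm r; congr (Rintegral _ _ _).
  by apply/funext => t; have [-> _] := ReIm_chi (P m n t) r t.
have fI : (fun r => Rintegral nu setT (fun t => complex.Im (P m n t) *
  complex.Re (chi r t))) =
    (fun r => polarL (fun t => complex.Re (chi r t)) (delta m) (imul (delta
    n))).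
  apply/funext => r; have [_ <-] := tm r; congr (Rintegral _ _ _).
  by apply/funext => t; have [_ ->] := ReIm_chi (P m n t) r t.
rewrite fR in cR; rewrite fI in cI.
have ER : Rintegral nu setT (fun t => complex.Re (P m n t)) =
    polarL (fun=> 1) (delta m) (delta n).
  by apply: (cvg_unique _ cR) => //; exact: polar_chi_cvg.
have EI : Rintegral nu setT (fun t => complex.Im (P m n t)) =
    polarL (fun=> 1) (delta m) (imul (delta n)).
  by apply: (cvg_unique _ cI) => //; exact: polar_chi_cvg.
have -> : c m n = cform c 0 0 (delta m) (delta n) by rewrite cform_delta !add0r.
by rewrite -polar_one_form -ER -EI.
Unshelve. all: by end_near. Qed.

End Representation.

(** A family with the prescribed moments of degree at most one and the convexity
    property determines a representing measure. *)
Lemma family_moment (R : realType) (d : nat) (c : mindex d -> mindex d -> R[i])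
    disp (T : measurableType disp) (z : T -> cspace R d)
    (mu : Xi R d -> {measure set T -> \bar R}) :
  (forall (xi : Xi R d) (m n : mindex d), (mlen m <= 1)%N -> (mlen n <= 1)%N ->
    has_cintegral (mu xi) (fun t => zmonom m (z t) * zbarmonom n (z t)) (cxi c
      xi m n)) ->
  (forall (xi eta : Xi R d) (A : set T), measurable A ->
    (0 <= mu (xi + eta)%R A + mu (xi - eta)%R A - 2%:E * mu eta A)%E) ->
  exists nu : {measure set T -> \bar R}, forall m n : mindex d,
    has_cintegral nu (fun t => zmonom m (z t) * zbarmonom n (z t)) (c m n).
Proof.
move=> mom cvx.
have [L [HL L1 Lxy Lsq [nu [nufin nuE]]]] := exists_functional mom cvx.
have [w1 mw] := weight_facts mom.
exists nu => m n; apply: (functional_moment (measurable_coord mom) w1 mw _ HL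
  L1 Lxy Lsq _ nufin nuE).
  by move=> j t; exact: weight_ge_coord.
exact: (cform00_real mom).
Qed.

(** * From a moment family to a convex family of measures *)
Section Density.
Context (R : realType) disp (T : measurableType disp).
Variables (nu : {measure set T -> \bar R}) (g : T -> R).
Hypothesis ig : nu.-integrable setT (EFin \o g).
Hypothesis g_ge0 : forall t, 0 <= g t.

Let mg : measurable_fun setT g.
Proof. by apply/measurable_EFinP; exact: measurable_int ig. Qed.

Let mgE A : measurable_fun A (fun t => (g t)%:E).
Proof. by apply: measurable_funTS; exact/measurable_EFinP. Qed.

Let gE_ge0 (A : set T) t : A t -> (0 <= (g t)%:E)%E.
Proof. by rewrite lee_fin. Qed.

(** The measure with density g with respect to nu. *)
Lemma density_exists : exists rho : {measure set T -> \bar R},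
  forall A, rho A = (\int[nu]_(t in A) (g t)%:E)%E.
Proof.
pose rho0 (A : set T) : \bar R := (\int[nu]_(t in A) (g t)%:E)%E.
have h0 : rho0 set0 = 0%E by exact: integral_set0.
have hge0 A : (0 <= rho0 A)%E by apply: integral_ge0 => t _; rewrite lee_fin.
have hsigma : semi_sigma_additive rho0.
  move=> F mF tF mUF; rewrite /rho0 ge0_integral_bigcup //; last exact: gE_ge0.
  by apply: is_cvg_ereal_nneg_natsum_cond => n _ _; exact: hge0.
pose rhoM := isMeasure.Build disp T R rho0 h0 hge0 hsigma.
pose rho : {measure set T -> \bar R} := HB.pack rho0 rhoM.
by exists rho.
Qed.

Variable rho : {measure set T -> \bar R}.
Hypothesis rhoE : forall A, rho A = (\int[nu]_(t in A) (g t)%:E)%E.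

Let rho_fin : (rho setT < +oo)%E.
Proof.
rewrite rhoE; move/integrableP : ig => [_].
by under eq_integral do rewrite gee0_abs ?lee_fin //.
Qed.

Let mul_integrable f : bounded_measurable f ->
  nu.-integrable setT (EFin \o (fun t => f t * g t)).
Proof.
move=> [mf [C fC]].
apply: (@le_integrable _ _ _ nu setT measurableT _ (fun t => `|C|%:E * (EFin \o
  g) t)%E).
- by apply/measurable_EFinP; exact: measurable_funM.
- move=> t _; rewrite /= lee_fin !normrM normr_id ler_wpM2r //.
  by rewrite (le_trans (fC t)) // ler_norm.
- exact: integrableZl.
Qed.

Lemma integral_density_bounded f : bounded_measurable f ->
  Rintegral rho setT f = Rintegral nu setT (fun t => f t * g t).
Proof.
move=> bf.
have PF : positive_functional (fun f : T -> R => Rintegral nu setT (fun t => f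
  t * g t)).
  split; last by move=> u _ u0; apply: Rintegral_ge0 => t _; rewrite mulr_ge0.
  move=> a u v bu bv.
  rewrite -RintegralZl //; last exact: mul_integrable.
  rewrite -RintegralD //; last exact: mul_integrable.
    by congr (Rintegral _ _ _); apply/funext => t; ring.
  rewrite (_ : _ \o _ = EFin \o (fun t => (a * u t) * g t)); last first.
    by apply/funext => t /=; rewrite mulrA.
  by apply: mul_integrable; exact: bmZ.
apply: (positive_functional_ext (Rintegral_positive_functional rho_fin) PF) =>
  //.
move=> A mA; rewrite /Rintegral integral_indic // setIT rhoE.
congr fine; rewrite integral_mkcond; apply: eq_integral => t _.
by rewrite /patch indicE; case: (t \in A); rewrite ?mul1r ?mul0r.
Qed.

Lemma ge0_integral_density (f : T -> R) : measurable_fun setT f -> (forall t, 0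
  <= f t) ->
  (\int[rho]_t (f t)%:E = \int[nu]_t (f t * g t)%:E)%E.
Proof.
move=> mf f0.
pose cut n : T -> R := \1_[set t | f t <= n%:R].
have mcut n : measurable_fun setT (cut n).
  apply: measurable_indic; rewrite (_ : mkset _ = setT `&` f @^-1` `]-oo,
    n%:R]); first exact: mf.
  by apply/seteqP; split=> t /=; rewrite in_itv /=; [|case].
have cutE n t : cut n t = if f t <= n%:R then 1 else 0.
  rewrite /cut indicE; case: ifPn => [h|/negP h]; first by rewrite mem_set.
  by rewrite memNset.
pose F n t : R := f t * cut n t.
have F0 n t : 0 <= F n t by rewrite /F cutE mulr_ge0 //; case: ifP.
have mF n : measurable_fun setT (F n) by exact: measurable_funM.
have bF n : bounded_measurable (F n).
  split; first exact: mF.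
  exists n%:R => t; rewrite ger0_norm // /F cutE; case: ifP => // h;
    rewrite ?mulr1 ?mulr0 //.
have Fnd t : {homo (fun n => F n t) : m n / (m <= n)%N >-> m <= n}.
  move=> m n mn; rewrite /F ler_wpM2l // !cutE; case: ifP => [h|_];
    last by case: ifP; rewrite ?ler01.
  by rewrite ifT // (le_trans h) // ler_nat.
have Flim t : \forall n \near \oo, F n t = f t.
  near=> n; rewrite /F cutE ifT ?mulr1 //.
  by near: n; exact: nbhs_infty_ger.
have h1 : (\int[rho]_t (F n t)%:E)%E @[n --> \oo] --> (\int[rho]_t (f t)%:E)%E.
  rewrite (_ : (\int[rho]_t (f t)%:E)%E = (\int[rho]_t (limn (fun n => (F n
    t)%:E)))%E); last first.
    apply: eq_integral => t _; apply/esym/cvg_lim => //; apply: cvg_near_cst.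
    by near=> n; congr (_%:E); near: n; exact: Flim.
  apply: (@cvg_monotone_convergence _ _ _ rho setT measurableT (fun n t => (F n
    t)%:E)).
  - by move=> n; apply/measurable_EFinP; exact: mF.
  - by move=> n t _; rewrite lee_fin.
  - by move=> t _ m n mn; rewrite lee_fin; exact: Fnd.
have h2 : (\int[nu]_t (F n t * g t)%:E)%E @[n --> \oo] --> (\int[nu]_t (f t * g
  t)%:E)%E.
  rewrite (_ : (\int[nu]_t (f t * g t)%:E)%E = (\int[nu]_t (limn (fun n => (F n
    t * g t)%:E)))%E); last first.
    apply: eq_integral => t _; apply/esym/cvg_lim => //; apply: cvg_near_cst.
    by near=> n; congr ((_ * _)%:E); near: n; exact: Flim.
  apply: (@cvg_monotone_convergence _ _ _ nu setT measurableT (fun n t => (F n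
    t * g t)%:E)).
  - by move=> n; apply/measurable_EFinP; exact: measurable_funM.
  - by move=> n t _; rewrite lee_fin mulr_ge0.
  - by move=> t _ m n mn; rewrite lee_fin ler_wpM2r //; exact: Fnd.
have E n : (\int[rho]_t (F n t)%:E = \int[nu]_t (F n t * g t)%:E)%E.
  rewrite -[LHS]fineK; last by apply: integrable_fin_num => //;
    exact: bounded_integrable.
  rewrite -[RHS]fineK; last by apply: integrable_fin_num => //;
    exact: mul_integrable.
  by congr EFin; exact: integral_density_bounded.
rewrite (funext E) in h1.
by apply: (cvg_unique _ h1 h2).
Unshelve. all: by end_near. Qed.

Lemma integral_density (f : T -> R) : measurable_fun setT f ->
  nu.-integrable setT (EFin \o (fun t => f t * g t)) ->
  rho.-integrable setT (EFin \o f) /\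
  Rintegral rho setT f = Rintegral nu setT (fun t => f t * g t).
Proof.
move=> mf ifg.
have mn : measurable_fun setT (fun t => `|f t|) by exact: measurableT_comp.
split.
  apply/integrableP; split; first exact/measurable_EFinP.
  rewrite (_ : (\int[rho]_t `|(EFin \o f) t|)%E = (\int[rho]_t (`|f t|)%:E)%E)
    //.
  rewrite ge0_integral_density //; move/integrableP : ifg => [_].
  by under eq_integral => t _ do rewrite /= normrM (ger0_norm (g_ge0 t)).
rewrite /Rintegral; congr fine.
rewrite integralE [RHS]integralE.
have mp : measurable_fun setT (fun t => Num.max (f t) 0).
  by apply: measurable_maxr => //; exact: measurable_cst.
have mm : measurable_fun setT (fun t => Num.max (- f t) 0).
  by apply: measurable_maxr; [exact: measurable_funN|exact: measurable_cst].
have max_ge0 (a : R) : 0 <= Num.max a 0 by rewrite le_max lexx orbT.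
congr (_ - _)%E.
  transitivity (\int[rho]_t (Num.max (f t) 0)%:E)%E.
    by apply: eq_integral => t _; rewrite funeposE -EFin_max.
  rewrite ge0_integral_density //; apply: eq_integral => t _.
  by rewrite funeposE -EFin_max; congr EFin; rewrite maxr_pMl // mul0r.
transitivity (\int[rho]_t (Num.max (- f t) 0)%:E)%E.
  by apply: eq_integral => t _; rewrite funenegE -EFinN -EFin_max.
rewrite ge0_integral_density //; apply: eq_integral => t _.
by rewrite funenegE -EFinN -EFin_max; congr EFin;
  rewrite maxr_pMl // mul0r mulNr.
Qed.

End Density.

Section ComplexIntegral.
Context (R : realType) disp (T : measurableType disp).
Variable nu : {measure set T -> \bar R}.
Implicit Types (f g : T -> R[i]) (u v a : R[i]).

Lemma has_cintegralD f g u v : has_cintegral nu f u -> has_cintegral nu g v ->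
  has_cintegral nu (fun t => f t + g t) (u + v).
Proof.
move=> [fR fI ->] [gR gI ->]; split.
- rewrite (_ : _ \o _ = (EFin \o (fun t => complex.Re (f t))) \+ (EFin \o (fun
  t => complex.Re (g t))))%E.
    exact: integrableD.
  by apply/funext => t /=; rewrite Re_add EFinD.
- rewrite (_ : _ \o _ = (EFin \o (fun t => complex.Im (f t))) \+ (EFin \o (fun
  t => complex.Im (g t))))%E.
    exact: integrableD.
  by apply/funext => t /=; rewrite Im_add EFinD.
- rewrite (_ : (fun t => complex.Re (f t + g t)) = (fun t => complex.Re (f t) +
  complex.Re (g t))); last first.
    by apply/funext => t; rewrite Re_add.
  rewrite (_ : (fun t => complex.Im (f t + g t)) = (fun t => complex.Im (f t) +
    complex.Im (g t))); last first.
    by apply/funext => t; rewrite Im_add.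
  by rewrite !RintegralD.
Qed.

Lemma has_cintegralZ a f u : has_cintegral nu f u ->
  has_cintegral nu (fun t => f t * a) (u * a).
Proof.
move=> [fR fI ->].
have lin (p q : R) : nu.-integrable setT (EFin \o (fun t => p * complex.Re (f
  t) + q * complex.Im (f t))) /\
    Rintegral nu setT (fun t => p * complex.Re (f t) + q * complex.Im (f t)) =
    p * Rintegral nu setT (fun t => complex.Re (f t)) + q * Rintegral nu setT
      (fun t => complex.Im (f t)).
  have iZ (s : R) (h : T -> R) : nu.-integrable setT (EFin \o h) ->
      nu.-integrable setT (EFin \o (fun t => s * h t)).
    by move=> ih; exact: (integrableZl measurableT s ih).
  split; first exact: (integrableD measurableT (iZ p _ fR) (iZ q _ fI)).
  rewrite RintegralD //; [|exact: iZ|exact: iZ].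
  by rewrite !RintegralZl.
have [i1 e1] := lin (complex.Re a) (- complex.Im a).
have [i2 e2] := lin (complex.Im a) (complex.Re a).
have RE : (fun t => complex.Re (f t * a)) =
    (fun t => complex.Re a * complex.Re (f t) + - complex.Im a * complex.Im (f
    t)).
  by apply/funext => t; rewrite Re_mul; ring.
have IE : (fun t => complex.Im (f t * a)) =
    (fun t => complex.Im a * complex.Re (f t) + complex.Re a * complex.Im (f
    t)).
  by apply/funext => t; rewrite Im_mul; ring.
split; rewrite ?RE ?IE //.
rewrite e1 e2; apply/eqP; rewrite eq_complex /=.
by apply/andP; split; apply/eqP; rewrite ?Re_mul ?Im_mul /=; ring.
Qed.

Lemma has_cintegral_sum (I : Type) (r : seq I) (F : I -> T -> R[i]) (V : I ->
  R[i]) :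
  (forall i, has_cintegral nu (F i) (V i)) ->
  has_cintegral nu (fun t => \sum_(i <- r) F i t) (\sum_(i <- r) V i).
Proof.
move=> FV; elim: r => [|i r IH]; last first.
  rewrite big_cons; under eq_fun do rewrite big_cons.
  exact: has_cintegralD.
rewrite big_nil; under eq_fun do rewrite big_nil.
have i0 : nu.-integrable setT (EFin \o (fun=> 0 : R)) by exact: integrable0.
split=> //=; apply/eqP; rewrite eq_complex /=.
by apply/andP; split; apply/eqP; rewrite /Rintegral integral0.
Qed.

End ComplexIntegral.

Section ToFamily.
Context (R : realType) (d : nat) (c : mindex d -> mindex d -> R[i]).
Context disp (T : measurableType disp) (z : T -> cspace R d).
Variable nu : {measure set T -> \bar R}.
Hypothesis nu_moments : forall m n : mindex d,
  has_cintegral nu (fun t => zmonom m (z t) * zbarmonom n (z t)) (c m n).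
Implicit Types (xi eta : Xi R d).

(** The polynomial with coefficients xi, and its squared modulus. *)
Definition polyn xi t : R[i] := mmap idfun (fun k => zmonom k (z t)) xi.

Definition polyn_sq xi t : R := complex.Re (polyn xi t) ^+ 2 + complex.Im
  (polyn xi t) ^+ 2.

Lemma polyn_sqE xi t : polyn xi t * Num.conj (polyn xi t) = Complex (polyn_sq
  xi t) 0.
Proof.
apply/eqP; rewrite eq_complex Re_mul Im_mul Re_conjc Im_conjc /=.
by apply/andP; split; apply/eqP; rewrite /polyn_sq; ring.
Qed.

Lemma polyn_sq_ge0 xi t : 0 <= polyn_sq xi t.
Proof. by rewrite addr_ge0 ?sqr_ge0. Qed.

Lemma polyn_sq0 t : polyn_sq 0 t = 0.
Proof. by rewrite /polyn_sq /polyn mmap0 /= expr0n addr0. Qed.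

Lemma polyn_sq_parallelogram xi eta t :
  polyn_sq (xi + eta) t + polyn_sq (xi - eta) t = 2 * (polyn_sq xi t + polyn_sq
    eta t).
Proof. by rewrite /polyn_sq /polyn mmapD mmapB !ReImE; ring. Qed.

Lemma weighted_moment xi m n :
  has_cintegral nu
    (fun t => zmonom m (z t) * zbarmonom n (z t) * Complex (polyn_sq xi t) 0)
    (cxi c xi m n).
Proof.
rewrite (_ : (fun t => _) = fun t => \sum_(k <- msupp xi) \sum_(l <- msupp xi)
    zmonom (m + k) (z t) * zbarmonom (n + l) (z t) * xi@_k * Num.conj xi@_l).
  by do 2!(apply: has_cintegral_sum => ?); do 2!apply: has_cintegralZ.
apply/funext => t; rewrite -polyn_sqE /polyn mmapE rmorph_sum /= big_distrlr /=
  mulr_sumr.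
apply: eq_bigr => k _; rewrite mulr_sumr; apply: eq_bigr => l _.
by rewrite !zbarmonomE !zmonomD !rmorphM /=; ring.
Qed.

Lemma polyn_sq_integrable xi : nu.-integrable setT (EFin \o polyn_sq xi).
Proof.
have [+ _ _] := weighted_moment xi 0 0.
congr (integrable _ _ (EFin \o _)); apply/funext => t.
by rewrite zbarmonomE !zmonom0 rmorph1 !mul1r.
Qed.

(** The family of the measures with densities |p_xi|^2. *)
Lemma moment_family : exists mu : Xi R d -> {measure set T -> \bar R},
  [/\ forall (xi : Xi R d) (m n : mindex d),
        has_cintegral (mu xi) (fun t => zmonom m (z t) * zbarmonom n (z t))
          (cxi c xi m n),
      forall A : set T, measurable A -> mu 0 A = 0%E &
      forall (xi eta : Xi R d) (A : set T), measurable A ->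
        (0 <= mu (xi + eta)%R A + mu (xi - eta)%R A - 2%:E * mu eta A)%E].
Proof.
have [mu muE] := choice (fun xi => density_exists (polyn_sq_integrable xi)
  (polyn_sq_ge0 xi)).
exists mu; split.
- move=> xi m n; have [iR iI ->] := weighted_moment xi m n.
  have RE : (fun t => complex.Re (zmonom m (z t) * zbarmonom n (z t) * Complex
    (polyn_sq xi t) 0)) =
      (fun t => complex.Re (zmonom m (z t) * zbarmonom n (z t)) * polyn_sq xi
      t).
    by apply/funext => t; rewrite Re_mul /= mulr0 subr0.
  have IE : (fun t => complex.Im (zmonom m (z t) * zbarmonom n (z t) * Complex
    (polyn_sq xi t) 0)) =
      (fun t => complex.Im (zmonom m (z t) * zbarmonom n (z t)) * polyn_sq xi
      t).
    by apply/funext => t; rewrite Im_mul /= mulr0 add0r.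
  rewrite RE in iR *; rewrite IE in iI *.
  have [/measurable_int/measurable_EFinP mR /measurable_int/measurable_EFinP mI
    _] := nu_moments m n.
  have [jR eR] := integral_density (polyn_sq_integrable xi) (polyn_sq_ge0 xi)
    (muE xi) mR iR.
  have [jI eI] := integral_density (polyn_sq_integrable xi) (polyn_sq_ge0 xi)
    (muE xi) mI iI.
  by split=> //; rewrite eR eI.
- move=> A mA; rewrite muE; under eq_integral do rewrite polyn_sq0;
  exact: integral0.
- move=> xi eta A mA.
  have iA x : nu.-integrable A (EFin \o polyn_sq x).
    by apply: integrableS (polyn_sq_integrable x).
  have muR x : mu x A = (Rintegral nu A (polyn_sq x))%:E.
    by rewrite muE /Rintegral fineK //; exact: (integrable_fin_num mA (iA x)).
  have ge0 : 0 <= Rintegral nu A (polyn_sq xi).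
    by apply: Rintegral_ge0 => t _; exact: polyn_sq_ge0.
  have E : Rintegral nu A (polyn_sq (xi + eta)) + Rintegral nu A (polyn_sq (xi
    - eta)) =
      2 * (Rintegral nu A (polyn_sq xi) + Rintegral nu A (polyn_sq eta)).
    rewrite -!RintegralD //; try exact: iA.
    rewrite -(@RintegralZl _ _ _ nu A (fun t => polyn_sq xi t + polyn_sq eta
      t)) //.
      by congr (Rintegral _ _ _); apply/funext => t;
        exact: polyn_sq_parallelogram.
    exact: (integrableD mA (iA xi) (iA eta)).
  rewrite !muR -EFinM -EFinN -!EFinD lee_fin.
  move: (Rintegral _ _ (polyn_sq (xi + eta))) (Rintegral _ _ (polyn_sq (xi -
    eta))) E.
  by move: (Rintegral _ _ (polyn_sq xi)) (Rintegral _ _ (polyn_sq eta)) ge0 =>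
    *; lra.
Qed.

End ToFamily.

Theorem theorem4 (R : realType) (d : nat) (hd : (1 <= d)%N)
    (c : mindex d -> mindex d -> R[i]) :
  is_moment c <->
  exists mu : Xi R d -> {measure set (borelC R d) -> \bar R},
    [/\ forall (xi : Xi R d) (m n : mindex d),
          (mlen m <= 1)%N -> (mlen n <= 1)%N ->
          has_cintegral (mu xi) (fun z => zmonom m z * zbarmonom n z)
            (cxi c xi m n),
        forall A : set (borelC R d), measurable A -> mu 0 A = 0%E &
        forall (xi eta : Xi R d) (A : set (borelC R d)), measurable A ->
          (0 <= mu (xi + eta)%R A + mu (xi - eta)%R A - 2%:E * mu eta A)%E].
Proof.
split=> [[nu nuP]|[mu [mom _ cvx]]].
  have [mu [h1 h2 h3]] := @moment_family R d c _ (borelC R d) (fun t => t) nu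
    nuP.
  by exists mu; split => // xi m n _ _; exact: h1.
exact: (@family_moment R d c _ (borelC R d) (fun t => t) mu mom cvx).
Qed.
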